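(* Let $\mathcal{A}_{ML}(\epsilon)$ be the MLMC estimator (defined in the context) for $\mathbb{E}[X]$, based on random variables $\{X_\ell\}$ satisfying Assumption A. Suppose $V_0>0$ and: (i) if $\beta=\gamma$, then $\lim_{k\to\infty}S_k=\infty$ and $$\lim_{\ell\to\infty}\mathbf{1}_{\{V_\ell>0\}}\,\mathbb{E}\Big[\frac{|\Delta_\ell X-\mathbb{E}[\Delta_\ell X]|^2}{V_\ell}\,\mathbf{1}\Big\{\frac{|\Delta_\ell X-\mathbb{E}[\Delta_\ell X]|^2}{V_\ell}>\nu\, S_\ell^2\, e^{(2\alpha-\gamma)\ell}\Big\}\Big]=0\quad\text{for all }\nu>0; \qquad (\ast)$$ (ii) if $\gamma>\beta$, then $\beta<2\alpha$, condition $(\ast)$ holds, and there exists $\upsilon\in[\beta,2\alpha)$ with $\liminf_{k\to\infty}S_k e^{(\upsilon-\gamma)k/2}>1$. (No further condition is imposed when $\beta>\gamma$.) Then $$\frac{\mathcal{A}_{ML}(\epsilon)-\mathbb{E}[X_{L(\epsilon)}]}{\sqrt{\mathrm{Var}(\mathcal{A}_{ML}(\epsilon))}}\xrightarrow{d}\mathcal{N}(0,1)\quad\text{as }\epsilon\downarrow 0.$$ In particular, if $\beta>\gamma$ and $V_0>0$, this CLT always holds.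
   Context: Let $(\Omega,\mathcal F,\mathbb P)$ be a probability space, $X\in L^2(\Omega)$ a real random variable and $\{X_\ell\}_{\ell=-1}^\infty\subset L^2(\Omega)$ with $X_{-1}:=0$. Put $\Delta_\ell X:=X_\ell-X_{\ell-1}$, $V_\ell:=\mathrm{Var}(\Delta_\ell X)$, and let $C_\ell>0$ denote the (given) cost of sampling $\Delta_\ell X$. Assumption A: there are positive constants $\alpha,\beta,\gamma$ with $\min(\beta,\gamma)\le 2\alpha$, and $c_\alpha>0$, such that for all $\ell\in\mathbb N_0$: $|\mathbb E[X-X_\ell]|\le c_\alpha e^{-\alpha\ell}$; $V_\ell\le C e^{-\beta\ell}$ for some constant $C>0$; and $c e^{\gamma\ell}<C_\ell<C' e^{\gamma\ell}$ for constants $0<c<C'$. Define $S_k:=\sum_{\ell=0}^k\sqrt{V_\ell C_\ell}$. MLMC estimator: for $\epsilon>0$, $L(\epsilon):=\max(\lceil \log(c_\alpha\epsilon^{-1})/\alpha\rceil,1)$, $M_\ell(\epsilon):=\max\big(\lceil \epsilon^{-2}\sqrt{V_\ell/C_\ell}\,S_{L(\epsilon)}\rceil,1\big)$, and $\mathcal A_{ML}(\epsilon):=\sum_{\ell=0}^{L(\epsilon)}\frac{1}{M_\ell(\epsilon)}\sum_{i=1}^{M_\ell(\epsilon)}\Delta_\ell X^i$, where the family $\{\Delta_\ell X^i\}_{\ell\in\mathbb N_0,i\in\mathbb N}$ is mutually independent and each $\Delta_\ell X^i$ has the law of $\Delta_\ell X$. Conventions: $0\cdot(\pm\infty)=0$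 and $0/0=0$. *)

(* Defs.v *)
From HB Require Import structures.
From mathcomp Require Import all_boot all_order all_algebra.
From mathcomp Require Import all_classical all_reals all_analysis.
Set Implicit Arguments. Unset Strict Implicit. Unset Printing Implicit Defensive.
Import Order.TTheory GRing.Theory Num.Theory.
Import numFieldNormedType.Exports.
Local Open Scope classical_set_scope.
Local Open Scope ring_scope.

Definition mutually_independent {d} {T : measurableType d} {R : realType}
  (P : probability T R) (I : eqType) (Y : I -> T -> R) : Prop :=
  forall (J : seq I) (B : I -> set R), uniq J ->
    (forall j, j \in J -> measurable (B j)) ->
    P (\big[setI/setT]_(j <- J) (Y j @^-1` B j)) =
    (\prod_(j <- J) P (Y j @^-1` B j))%E.

Definition int_to_nat (z : int) : nat := if z is Posz n then n else 0%N.

(* Delta_l X := X_l - X_{l-1}, with X_{-1} := 0 *)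
Definition DeltaX {T : Type} {R : pzRingType} (Xs : nat -> T -> R) (l : nat) : T -> R :=
  fun w => if l is l'.+1 then Xs l w - Xs l' w else Xs 0%N w.

Section mlmc.
Context {d} {T : measurableType d} {R : realType} (P : probability T R).

Definition Vl (Xs : nat -> T -> R) (l : nat) : R := fine ('V_P[DeltaX Xs l]).

Definition Sk (Xs : nat -> T -> R) (Cost : nat -> R) (k : nat) : R :=
  \sum_(0 <= l < k.+1) Num.sqrt (Vl Xs l * Cost l).

Definition Leps (alpha c_alpha eps : R) : nat :=
  maxn (int_to_nat (Num.ceil (ln (c_alpha / eps) / alpha))) 1.

Definition Meps (Xs : nat -> T -> R) (Cost : nat -> R) (alpha c_alpha eps : R)
  (l : nat) : nat :=
  maxn (int_to_nat (Num.ceil (eps ^-2 * Num.sqrt (Vl Xs l / Cost l)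
                              * Sk Xs Cost (Leps alpha c_alpha eps)))) 1.

(* the MLMC estimator, built from the copies Y l i of Delta_l X *)
Definition A_ML (Xs : nat -> T -> R) (Cost : nat -> R) (Y : nat -> nat -> T -> R)
  (alpha c_alpha eps : R) : T -> R :=
  fun w => \sum_(0 <= l < (Leps alpha c_alpha eps).+1)
     ((Meps Xs Cost alpha c_alpha eps l)%:R^-1 *
      \sum_(1 <= i < (Meps Xs Cost alpha c_alpha eps l).+1) Y l i w).

Definition cond_star (Xs : nat -> T -> R) (Cost : nat -> R) (alpha gamma : R) : Prop :=
  forall nu : R, 0 < nu ->
    (fun l : nat =>
       if 0 < Vl Xs l then
         'E_P[fun w =>
           (let W := (`|DeltaX Xs l w - fine 'E_P[DeltaX Xs l]| ^+ 2) / Vl Xs l in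
            W *
            (if W > nu * Sk Xs Cost l ^+ 2 * expR ((2 * alpha - gamma) * l%:R)
             then 1 else 0))%R]%E
       else 0%E) @ \oo --> 0%E.
End mlmc.

(* Main.v *)
(** By independence the normalised estimation error is a sum W of independent
    centred variables of total variance 1, and the theorem is a Lindeberg central
    limit theorem for this triangular array.

    The limit theorem is proved by Stein's method.  For a continuous h with values
    in [0, 1] the equation f' x - x f x = h x - N h, N h being the Gaussian mean
    of h, has a bounded solution with bounded continuous derivative.  A first
    order expansion of f around W - U, for each summand U, bounds
    E[f' W - W f W] by the modulus of continuity of f' on a compact set plus the
    Lindeberg sum.  Ramps squeeze the indicator of a half line.

    For the estimator with n = L(eps), write b_l = sqrt(V_l C_l), so that
    S_n = b_0 + ... + b_n.  Once Var A >= c eps^2 is known, the Lindeberg sum is at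
    most 1/c times the average, with weights b_l / S_n, of the truncated
    normalised second moments of Delta_l X at a level that grows with n and is at
    least the one in condition (star).  If beta > gamma the weights have a
    geometric tail, and otherwise (star) controls the levels with large l; the
    remaining levels are finitely many and each of them contributes o(1).  The
    variance bound comes from level 0 if S is bounded, and otherwise from S_n^2
    dominating exp((gamma - 2 alpha) n). *)

Require Import Defs.
From HB Require Import structures.
From mathcomp Require Import all_boot all_order all_algebra.
From mathcomp Require Import all_classical all_reals all_analysis.
From mathcomp Require Import measurable_realfun.
From mathcomp Require Import ring lra.
Import Order.TTheory GRing.Theory Num.Theory.
Import numFieldNormedType.Exports.
Local Open Scope classical_set_scope.
Local Open Scope ring_scope.
Set Implicit Arguments.
Unset Strict Implicit.
Unset Printing Implicit Defensive.

(** * Independence *)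

Section independence.
Context {d} {T : measurableType d} {R : realType}.
Implicit Types (U V : T -> R) (A B C : set R).

Lemma measurable_preimage U A : measurable_fun setT U -> measurable A ->
  measurable (U @^-1` A).
Proof. by move=> mU mA; rewrite -[X in measurable X]setTI; exact: mU. Qed.

(** Measurable rectangles form a pi-system generating the product sigma-algebra, so two finite image
    measures that agree on them coincide. General measures are allowed because the application
    restricts and rescales [P]. *)
Lemma eq_measure_pair (m1 m2 : {measure set T -> \bar R}) U V :
  measurable_fun setT U -> measurable_fun setT V -> (m1 setT < +oo)%E ->
  (forall A B, measurable A -> measurable B ->
    m1 (U @^-1` A `&` V @^-1` B) = m2 (U @^-1` A `&` V @^-1` B)) ->
  forall C : set (R * R), measurable C ->
    m1 ((fun w => (U w, V w)) @^-1` C) = m2 ((fun w => (U w, V w)) @^-1` C).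
Proof.
move=> mU mV m1oo m12 C mC.
have mUV : measurable_fun setT (fun w => (U w, V w)) by exact: measurable_fun_pair.
pose G : set (set (R * R)) :=
  [set C | exists A, measurable A /\ exists B, measurable B /\ C = A `*` B].
have CI : setI_closed G.
  move=> /= _ _ [X1 [mX1 [X2 [mX2 ->]]]] [Y1 [mY1 [Y2 [mY2 ->]]]].
  rewrite -setXI; exists (X1 `&` Y1); split; first exact: measurableI.
  by exists (X2 `&` Y2); split => //; exact: measurableI.
pose M (m : {measure set T -> \bar R}) : {measure set (R * R) -> \bar R} :=
  measure_function_pushforward__canonical__measure_function_Measure m mUV.
apply: (@measure_unique _ R (R * R)%type G (fun=> setT) _ CI _ _ (M m1) (M m2) _ _ _ mC).
- rewrite measurable_prod_measurableType //; congr (<<s _ >>).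
  rewrite predeqE; split => [[A mA [B mB <-]]|[A [mA [B [mB ->]]]]].
    by exists A; split => //; exists B.
  by exists A => //; exists B.
- by move=> _; exists setT; split => //; exists setT; rewrite setXTT.
- by rewrite bigcup_const.
- by move=> _ [A [mA [B [mB ->]]]]; exact: m12.
- by move=> _; exact: m1oo.
Qed.

Variable P : probability T R.

Definition indep2 U V := forall A B, measurable A -> measurable B ->
  P (U @^-1` A `&` V @^-1` B) = (P (U @^-1` A) * P (V @^-1` B))%E.

(* The summands of J are absorbed into the sum one at a time: by eq_measure_pair
   it suffices to know the joint law of a new summand and the partial sum. *)
Lemma mutually_independent_cons (I : eqType) (Y : I -> T -> R) (j : I)
    (J K : seq I) : (forall i, measurable_fun setT (Y i)) ->
    mutually_independent P Y -> uniq (j :: J ++ K) ->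
  forall A B (D : I -> set R), measurable A -> measurable B ->
    (forall k, measurable (D k)) ->
  P (Y j @^-1` A `&` ((fun w => \sum_(i <- J) Y i w) @^-1` B `&`
       \big[setI/setT]_(k <- K) (Y k @^-1` D k))) =
  (P (Y j @^-1` A) * P ((fun w => \sum_(i <- J) Y i w)%R @^-1` B `&`
       \big[setI/setT]_(k <- K) (Y k @^-1` D k)))%E.
Proof.
move=> mY iY; elim: J K => [|a J IH] K.
  move=> /= /andP[jK uK] A B D mA mB mD.
  have -> : (fun w : T => \sum_(i <- [::]) Y i w) = cst 0.
    by apply/funext => w; rewrite big_nil.
  rewrite preimage_cst; case: ifPn => _; last by rewrite !(set0I,setI0) measure0 mule0.
  (* The constraint on [Y j] is stored in the family at index [j]; since [j] is not in [K], the
     intersection over [K] is unchanged. *)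
  rewrite setTI; pose D' k := if k == j then A else D k.
  have DK : \big[setI/setT]_(k <- K) (Y k @^-1` D k) =
            \big[setI/setT]_(k <- K) (Y k @^-1` D' k).
    apply: eq_big_seq => k kK; rewrite /D'; case: eqP => // kj.
    by move: jK; rewrite -kj kK.
  have mD' k : measurable (D' k) by rewrite /D'; case: ifP.
  have ujK : uniq (j :: K) by rewrite /= jK.
  have := iY (j :: K) D' ujK (fun k _ => mD' k).
  by rewrite !big_cons DK (iY K D' uK (fun k _ => mD' k)) /D' eqxx; exact.
move=> uJ A B D mA mB mD.
have /IH {}IH : uniq (j :: J ++ a :: K).
  rewrite -(perm_uniq (_ : perm_eq (j :: (a :: J) ++ K) _)) //.
  by rewrite perm_cons -cat1s -(cat1s a K) !catA perm_cat2r perm_catC.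
pose S w := \sum_(i <- J) Y i w.
have mS : measurable_fun setT S by exact: measurable_sum.
have mDK : measurable (\big[setI/setT]_(k <- K) (Y k @^-1` D k)).
  by apply: bigsetI_measurable => k _; exact: measurable_preimage.
set E := \big[setI/setT]_(k <- K) _ in mDK *.
have mAj : measurable (Y j @^-1` A) by exact: measurable_preimage.
have mAE : measurable (Y j @^-1` A `&` E) by exact: measurableI.
have -> : (fun w => \sum_(i <- a :: J) Y i w) @^-1` B =
    (fun w => (Y a w, S w)) @^-1` ((fun z : R * R => z.1 + z.2) @^-1` B).
  by apply/seteqP; split => w /=; rewrite big_cons.
have mplus : measurable ((fun z : R * R => z.1 + z.2) @^-1` B).
  rewrite -[X in measurable X]setTI; apply: measurable_funD => //; exact: measurable_fst || exact: measurable_snd.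
have p0 : 0 <= fine (P (Y j @^-1` A)) by exact: fine_ge0.
pose r := NngNum p0.
(* [m1] is [P] restricted to the event that [Y j] lies in [A] and [E] holds; [m2] is [P] restricted
   to [E], scaled by the probability of the former. On rectangles for [(Y a, S)] their equality is
   the induction hypothesis. *)
pose m1 : {measure set T -> \bar R} := mrestr P mAE.
pose m2 : {measure set T -> \bar R} := mscale r (mrestr P mDK).
have := @eq_measure_pair m1 m2 (Y a) S (mY a) mS _ _ _ mplus.
rewrite /m1 /m2 /= /mscale /= /mrestr /= fineK ?fin_num_measure// => H.
rewrite setIA [_ `&` _ @^-1` _]setIC -setIA; apply: H.
  by rewrite setTI (le_lt_trans (probability_le1 _ _))// ltry.
move=> A1 B1 mA1 mB1.
pose D' k := if k == a then A1 else D k.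
have mD' k : measurable (D' k) by rewrite /D'; case: ifP.
have DK : \big[setI/setT]_(k <- K) (Y k @^-1` D' k) = E.
  apply: eq_big_seq => k kK; rewrite /D'; case: eqP => // ka.
  move: uJ => /= /andP[_ /andP[]]; rewrite mem_cat negb_or => /andP[_].
  by rewrite -ka kK.
have := IH A B1 D' mA mB1 mD'; rewrite big_cons DK /D' eqxx -/S => IHE.
have e2 : Y a @^-1` A1 `&` S @^-1` B1 `&` E = S @^-1` B1 `&` (Y a @^-1` A1 `&` E).
  by rewrite setIA [S @^-1` _ `&` _]setIC.
by rewrite e2 -IHE; congr (P _); rewrite !setIA; do 2 (rewrite [RHS]setIC; symmetry); apply/seteqP; split => w /=; tauto.
Qed.

Lemma indep2_sum (I : eqType) (Y : I -> T -> R) (j : I) (J : seq I) :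
    (forall i, measurable_fun setT (Y i)) ->
    mutually_independent P Y -> uniq (j :: J) ->
  indep2 (Y j) (fun w => \sum_(i <- J) Y i w).
Proof.
move=> mY iY uJ A B mA mB.
have := @mutually_independent_cons _ Y j J [::] mY iY _ A B (fun=> setT) mA mB.
by rewrite cats0 big_nil setIT; exact.
Qed.

Lemma indep2_comp U V (f g : R -> R) : measurable_fun setT f ->
  measurable_fun setT g -> indep2 U V -> indep2 (f \o U) (g \o V).
Proof.
move=> mf mg UV A B mA mB.
by apply: (UV (f @^-1` A) (g @^-1` B)); rewrite -[X in measurable X]setTI; [exact: mf|exact: mg].
Qed.

(** The joint law is the product of the two laws by uniqueness of product measures. Tonelli makes
    the integral of [|x y|] a product of two finite absolute moments, after which Fubini factorises
    the expectation. *)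
Lemma indep2_mul U V : measurable_fun setT U -> measurable_fun setT V ->
    indep2 U V ->
    P.-integrable setT (EFin \o U) -> P.-integrable setT (EFin \o V) ->
  P.-integrable setT (EFin \o (U \* V)) /\
  (\int[P]_w (U w * V w) = (\int[P]_w U w) * (\int[P]_w V w))%R.
Proof.
move=> mU mV UV iU iV.
pose X : {RV P >-> R} := HB.pack U (isMeasurableFun.Build _ _ _ _ U mU).
pose Y : {RV P >-> R} := HB.pack V (isMeasurableFun.Build _ _ _ _ V mV).
have mUV : measurable_fun setT (fun w => (U w, V w)) by exact: measurable_fun_pair.
pose m : {measure set (R * R) -> \bar R} :=
  measure_function_pushforward__canonical__measure_function_Measure P mUV.
pose m1 := distribution P X; pose m2 := distribution P Y.
have mE (C : set (R * R)) : measurable C -> (m1 \x m2)%E C = m C.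
  by apply: product_measure_unique => A B mA mB; exact: UV.
have mprod : measurable_fun setT (fun z : R * R => (z.1 * z.2)%:E).
  apply/measurable_EFinP; apply: measurable_funM.
    exact: measurable_fst.
  exact: measurable_snd.
have mid : measurable_fun [set: R] (fun x : R => x%:E) by exact/measurable_EFinP.
have iX : m1.-integrable setT (fun x => x%:E) by exact: integrable_pushforward.
have iY : m2.-integrable setT (fun x => x%:E) by exact: integrable_pushforward.
have EX : (\int[m1]_x x%:E = \int[P]_w (U w)%:E)%E by rewrite integral_pushforward.
have EY : (\int[m2]_x x%:E = \int[P]_w (V w)%:E)%E by rewrite integral_pushforward.
have iprod : (m1 \x m2)%E.-integrable setT (fun z : R * R => (z.1 * z.2)%:E).
  apply/integrable12ltyP => //=.
  have mabs : measurable_fun [set: R] (fun y : R => `|y|%:E).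
    by apply/measurable_EFinP; exact: normr_measurable.
  under eq_integral => x _.
    under eq_integral => y _ do rewrite normrM EFinM.
    rewrite (@ge0_integralZl _ _ _ m2)//.
    over.
  move/integrableP : iX => [_ /= iX]; move/integrableP : iY => [_ /= iY].
  rewrite (@ge0_integralZr _ _ _ m1)//; last exact: integral_ge0.
  by rewrite lte_mul_pinfty ?integral_ge0// ge0_fin_numE ?integral_ge0.
have iUV : P.-integrable setT (EFin \o (U \* V)).
  apply/integrableP; split; first exact/measurable_EFinP/measurable_funM.
  move/integrableP : iprod => [_].
  rewrite (@eq_measure_integral _ _ _ setT m)/=; last by move=> A mA _; rewrite -mE.
  rewrite (@ge0_integral_pushforward _ _ _ _ _ _ mUV)//.
  by apply/measurable_EFinP; apply: measurableT_comp => //; exact/measurable_EFinP.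
split=> //; rewrite /Rintegral -fineM ?integrable_fin_num//; congr fine.
transitivity (\int[m]_z (z.1 * z.2)%:E)%E.
  by rewrite integral_pushforward.
rewrite -(@eq_measure_integral _ _ _ setT m (m1 \x m2)%E)/=; last first.
  by move=> A mA _; rewrite mE.
rewrite -integral12_prod_meas1//= /fubini_F/=.
under eq_integral => x _.
  under eq_integral => y _ do rewrite EFinM.
  rewrite integralZl//.
  over.
have /fineK <- : (\int[m2]_y y%:E)%E \is a fin_num by rewrite EY integrable_fin_num.
by rewrite integralZr// EX -EY fineK// EY integrable_fin_num.
Qed.

End independence.

(** * Expectations and one step of Stein's method *)

Section expectation_toolkit.
Context {d} {T : measurableType d} {R : realType} (P : probability T R).
Implicit Types (f g U V : T -> R) (a : R).

Definition Lone f := P.-integrable setT (EFin \o f).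
Definition Ex f : R := \int[P]_w f w.

Lemma Lone_measurable f : Lone f -> measurable_fun setT f.
Proof. by move=> /measurable_int/measurable_EFinP. Qed.

Lemma LoneD f g : Lone f -> Lone g -> Lone (fun w => f w + g w).
Proof. exact: integrableD. Qed.

Lemma LoneB f g : Lone f -> Lone g -> Lone (fun w => f w - g w).
Proof. exact: integrableB. Qed.

Lemma LoneZ a f : Lone f -> Lone (fun w => a * f w).
Proof. exact: integrableZl. Qed.

Lemma Lone_cst a : Lone (fun=> a).
Proof. exact: finite_measure_integrable_cst. Qed.

Lemma Lone_sum (I : eqType) (s : seq I) (F : I -> T -> R) :
  (forall i, i \in s -> Lone (F i)) -> Lone (fun w => \sum_(i <- s) F i w).
Proof.
elim: s => [_|i s IH H].
  rewrite (_ : (fun _ => _) = fun=> 0); first exact: Lone_cst.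
  by apply/funext => w; rewrite big_nil.
rewrite (_ : (fun _ => _) = fun w => F i w + \sum_(i <- s) F i w).
  by apply: LoneD; [apply: H; rewrite mem_head|apply: IH => k ks; apply: H; rewrite inE ks orbT].
by apply/funext => w; rewrite big_cons.
Qed.

Lemma Lone_le f g : measurable_fun setT f -> Lone g ->
  (forall w, `|f w| <= g w) -> Lone f.
Proof.
move=> mf ig fg; apply: le_integrable ig => //; first exact/measurable_EFinP.
by move=> w _ /=; rewrite lee_fin (le_trans (fg w))// ler_norm.
Qed.

Lemma Lone_mul_bounded f g a : Lone f -> measurable_fun setT g ->
  (forall w, `|g w| <= a) -> Lone (fun w => f w * g w).
Proof.
move=> Lf mg ga.
have Lnf : Lone (fun w => a * `|f w|) by apply: LoneZ; exact: integrable_norm.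
apply: (Lone_le _ Lnf).
  by apply: measurable_funM => //; exact: Lone_measurable.
by move=> w; rewrite normrM mulrC ler_wpM2r.
Qed.

Lemma Lone_sqr f : measurable_fun setT f -> Lone (fun w => f w ^+ 2) -> Lone f.
Proof.
move=> mf Lf.
apply: (Lone_le mf (LoneD (Lone_cst 1) Lf)) => w.
by rewrite ler_norml; apply/andP; split; nra.
Qed.

Lemma ExD f g : Lone f -> Lone g -> Ex (fun w => f w + g w) = Ex f + Ex g.
Proof. exact: RintegralD. Qed.

Lemma ExB f g : Lone f -> Lone g -> Ex (fun w => f w - g w) = Ex f - Ex g.
Proof. exact: RintegralB. Qed.

Lemma ExZ a f : Lone f -> Ex (fun w => a * f w) = a * Ex f.
Proof. by move=> Lf; apply: RintegralZl. Qed.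

Lemma Ex_cst a : Ex (fun=> a) = a.
Proof.
by rewrite /Ex Rintegral_cst// -[RHS]mulr1; congr (_ * _); exact: (congr1 fine (probability_setT P)).
Qed.

Lemma Ex_sum (I : eqType) (s : seq I) (F : I -> T -> R) :
  (forall i, i \in s -> Lone (F i)) ->
  Ex (fun w => \sum_(i <- s) F i w) = \sum_(i <- s) Ex (F i).
Proof.
elim: s => [_|i s IH H].
  rewrite big_nil -[RHS](Ex_cst 0); congr Ex.
  by apply/funext => w; rewrite big_nil.
rewrite big_cons -IH => [|k ks]; last by apply: H; rewrite inE ks orbT.
rewrite -ExD; last 2 first.
- by apply: H; rewrite mem_head.
- by apply: Lone_sum => k ks; apply: H; rewrite inE ks orbT.
by congr Ex; apply/funext => w; rewrite big_cons.
Qed.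

Lemma Ex_le f g : Lone f -> Lone g -> (forall w, f w <= g w) -> Ex f <= Ex g.
Proof. by move=> Lf Lg fg; apply: le_Rintegral. Qed.

Lemma Ex_ge0 f : (forall w, 0 <= f w) -> 0 <= Ex f.
Proof. by move=> f0; apply: Rintegral_ge0. Qed.

Lemma Ex_norm_le f g : Lone f -> Lone g -> (forall w, `|f w| <= g w) ->
  `|Ex f| <= Ex g.
Proof.
move=> Lf Lg fg; apply: le_trans (le_normr_Rintegral measurableT Lf) _.
by apply: le_Rintegral => //; exact: integrable_norm.
Qed.

Lemma ExM U V : Lone U -> Lone V -> indep2 P U V ->
  Lone (fun w => U w * V w) /\ Ex (fun w => U w * V w) = Ex U * Ex V.
Proof.
by move=> LU LV UV; apply: indep2_mul => //; exact: Lone_measurable.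
Qed.

Definition trunc_sqr (a : R) U w := if a < `|U w| then U w ^+ 2 else 0.

Lemma measurable_trunc_sqr a U : measurable_fun setT U ->
  measurable_fun setT (trunc_sqr a U).
Proof.
move=> mU; apply: measurable_fun_ifT => //; last exact: measurable_funX.
by apply: measurable_fun_ltr => //; exact: measurableT_comp.
Qed.

Lemma trunc_sqr_ge0 a U w : 0 <= trunc_sqr a U w.
Proof. by rewrite /trunc_sqr; case: ifP => // _; exact: sqr_ge0. Qed.

Lemma Lone_trunc_sqr a U : measurable_fun setT U ->
  Lone (fun w => U w ^+ 2) -> Lone (trunc_sqr a U).
Proof.
move=> mU LU; apply: (Lone_le _ LU); first exact: measurable_trunc_sqr.
move=> w; rewrite ger0_norm ?trunc_sqr_ge0// /trunc_sqr; case: ifP => // _.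
exact: sqr_ge0.
Qed.

(** Expanding the square, the cross term of a new summand with the partial sum has expectation 0 by
    independence and centring. *)
Lemma Ex_sqr_sum (I : eqType) (Y : I -> T -> R) (J : seq I) :
  (forall i, measurable_fun setT (Y i)) -> mutually_independent P Y ->
  (forall i, Lone (fun w => Y i w ^+ 2)) -> (forall i, Ex (Y i) = 0) ->
  uniq J ->
  Lone (fun w => (\sum_(i <- J) Y i w) ^+ 2) /\
  Ex (fun w => (\sum_(i <- J) Y i w) ^+ 2) = \sum_(i <- J) Ex (fun w => Y i w ^+ 2).
Proof.
move=> mY iY LY EY; elim: J => [_|j J IH uJ].
  rewrite big_nil (_ : (fun w => _) = fun=> 0); last first.
    by apply/funext => w; rewrite big_nil expr0n.
  by rewrite Ex_cst; split=> //; exact: Lone_cst.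
have [|LS ES] := IH; first by case/andP: uJ.
have mS : measurable_fun setT (fun w => \sum_(i <- J) Y i w) by exact: measurable_sum.
have LYj : Lone (Y j) by exact: Lone_sqr.
have [LM EM] := ExM LYj (Lone_sqr mS LS) (indep2_sum mY iY uJ).
have -> : (fun w => (\sum_(i <- j :: J) Y i w) ^+ 2) =
  (fun w => (Y j w ^+ 2 + (\sum_(i <- J) Y i w) ^+ 2) + 2 * (Y j w * \sum_(i <- J) Y i w)).
  by apply/funext => w; rewrite big_cons; ring.
split; first by apply: LoneD; [exact: LoneD|exact: LoneZ].
rewrite ExD; [|exact: LoneD|exact: LoneZ].
by rewrite ExD// ExZ// EM EY mul0r mulr0 addr0 ES big_cons.
Qed.

End expectation_toolkit.

Section stein_pair.
Context {d} {T : measurableType d} {R : realType} (P : probability T R).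
Variables (f f' : R -> R) (C M eta kappa N delta : R).
Hypothesis df : forall x : R, is_derive x 1 f (f' x).
Hypothesis mf' : measurable_fun setT f'.
Hypothesis fC : forall x, `|f x| <= C.
Hypothesis f'M : forall x, `|f' x| <= M.
Hypotheses (N0 : 0 <= N) (delta0 : 0 < delta).
Hypothesis f'mod : forall x y,
  `|f' y - f' x| <= eta + kappa * x ^+ 2 + N * (delta < `|y - x|)%R%:R.

Let cf : continuous f.
Proof.
move=> x; apply/differentiable_continuous/derivable1_diffP.
by case: (df x).
Qed.

(** By the mean value theorem the increment of [f] is [u * f' c] with [|c - x| <= |u|], so the error
    is [u ^+ 2 * (f' c - f' x)]. The jump term of the modulus can only appear when [|u|] exceeds
    [delta]. *)
Let taylor x u :
  `|u * f (u + x) - u * f x - u ^+ 2 * f' x| <=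
  eta * u ^+ 2 + kappa * (u ^+ 2 * x ^+ 2) + N * (if delta < `|u| then u ^+ 2 else 0).
Proof.
have [c cx ->] : exists2 c, `|c - x| <= `|u| & f (u + x) = f x + u * f' c.
  have [u0|u0] := leP 0 u.
    have xux : x <= u + x by rewrite lerDr.
    have [c cI e] := MVT_segment xux (fun y _ => df y) (continuous_subspaceT cf).
    exists c; last by rewrite -[LHS](subrK (f x)) e; ring.
    by move: cI; rewrite in_itv/= => /andP[? ?]; rewrite !ger0_norm ?subr_ge0// lerBlDr.
  have uxx : u + x <= x by rewrite gerDr ltW.
  have [c cI e] := MVT_segment uxx (fun y _ => df y) (continuous_subspaceT cf).
  exists c; last by rewrite -[in RHS](subrK (f (u + x)) (f x)) e; ring.
  by move: cI; rewrite in_itv/= => /andP[? ?]; rewrite (ltr0_norm u0) ler0_norm ?subr_le0//; lra.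
have -> : u * (f x + u * f' c) - u * f x - u ^+ 2 * f' x = u ^+ 2 * (f' c - f' x) by ring.
rewrite normrM (ger0_norm (sqr_ge0 u)).
apply: (@le_trans _ _ (u ^+ 2 * (eta + kappa * x ^+ 2 + N * (delta < `|u|)%R%:R))).
  apply: ler_wpM2l; first exact: sqr_ge0.
  apply: (le_trans (f'mod _ _)); rewrite lerD2l ler_wpM2l// ler_nat.
  case: (ltP delta `|c - x|) => // h; by rewrite (lt_le_trans h cx).
by case: ifP => _ /=; rewrite le_eqVlt; apply/orP; left; apply/eqP; ring.
Qed.

(* U is one summand and V the sum of the others: E[U f V] = 0 and
   E[U^2 f' V] = a E[f' V], so both error terms come from first order expansions
   of f and f' around V. *)
Lemma stein_pair (U V : T -> R) :
  measurable_fun setT U -> measurable_fun setT V -> indep2 P U V ->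
  Lone P (fun w => U w ^+ 2) -> Lone P (fun w => V w ^+ 2) -> Ex P U = 0 ->
  let a := Ex P (fun w => U w ^+ 2) in
  let v := Ex P (fun w => V w ^+ 2) in
  let t := Ex P (trunc_sqr delta U) in
  Lone P (fun w => U w * f (U w + V w)) /\
  `|Ex P (fun w => U w * f (U w + V w)) - a * Ex P (fun w => f' (U w + V w))| <=
  2 * a * (eta + kappa * v) + N * t * (1 + a / delta ^+ 2).
Proof.
move=> mU mV UV LU2 LV2 EU a v t.
have LU := Lone_sqr mU LU2.
have mf : measurable_fun setT f by exact: continuous_measurable_fun.
have mUV : measurable_fun setT (fun w => U w + V w) by exact: measurable_funD.
have Lbd (g : R -> R) (W : T -> R) (B : R) : measurable_fun setT g ->
    measurable_fun setT W -> (forall x, `|g x| <= B) -> Lone P (fun w => g (W w)).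
  move=> mg mW gB; apply: (Lone_le _ (Lone_cst P B)) => //.
  exact: (measurableT_comp mg mW).
have LUf : Lone P (fun w => U w * f (U w + V w)).
  by apply: (Lone_mul_bounded LU (a := C)) => //; exact: (measurableT_comp mf mUV).
split=> //.
have Lf'UV := Lbd _ _ _ mf' mUV f'M.
have Lf'V := Lbd _ _ _ mf' mV f'M.
have LfV := Lbd _ _ _ mf mV fC.
have mid : measurable_fun setT (@id R) by exact: measurable_id.
have [LUfV EUfV] := ExM LU LfV (indep2_comp mid mf UV).
have msq : measurable_fun setT (fun x : R => x ^+ 2) by exact: exprn_measurable.
have [LUf'V EUf'V] := ExM LU2 Lf'V (indep2_comp msq mf' UV).
have [LUV EUV] := ExM LU2 LV2 (indep2_comp msq msq UV).
have Lt : Lone P (trunc_sqr delta U) by exact: Lone_trunc_sqr.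
have LD1 := LoneB (LoneB LUf LUfV) LUf'V.
have LB1 := LoneD (LoneD (LoneZ eta LU2) (LoneZ kappa LUV)) (LoneZ N Lt).
have := Ex_norm_le LD1 LB1 (fun w => taylor (V w) (U w)).
rewrite (ExB (LoneB LUf LUfV) LUf'V) (ExB LUf LUfV) EUfV EU mul0r subr0 EUf'V.
rewrite (ExD (LoneD (LoneZ eta LU2) (LoneZ kappa LUV)) (LoneZ N Lt)).
rewrite (ExD (LoneZ eta LU2) (LoneZ kappa LUV)) !ExZ// EUV -/a -/v -/t => B1.
have LD2 := LoneB Lf'UV Lf'V.
have LB2 := LoneD (LoneD (Lone_cst P eta) (LoneZ kappa LV2)) (LoneZ (N / delta ^+ 2) Lt).
(* The indicator of [delta < |U|] is bounded by the truncated square over [delta ^+ 2], as in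
   Chebyshev's inequality. *)
have dd w : `|f' (U w + V w) - f' (V w)| <=
    eta + kappa * V w ^+ 2 + N / delta ^+ 2 * trunc_sqr delta U w.
  apply: (le_trans (f'mod _ _)); rewrite lerD2l addrK -mulrA ler_wpM2l//.
  rewrite /trunc_sqr; case: ifP => h /=; last by rewrite mulr0.
  rewrite mulrC ler_pdivlMr ?exprn_gt0// mul1r -[leRHS]real_normK ?num_real//.
  by apply: lerXn2r; rewrite ?nnegrE ?normr_ge0// ltW.
have := Ex_norm_le LD2 LB2 dd.
rewrite (ExB Lf'UV Lf'V) (ExD (LoneD (Lone_cst P eta) (LoneZ kappa LV2)) (LoneZ _ Lt)).
rewrite (ExD (Lone_cst P eta) (LoneZ kappa LV2)) !ExZ// Ex_cst -/v -/t => B2.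
have a0 : 0 <= a by apply: Ex_ge0 => w; exact: sqr_ge0.
set e1 := Ex P (fun w => U w * f _) in B1 *.
set e2 := Ex P (fun w => f' (V w)) in B1 B2 *.
set e3 := Ex P (fun w => f' (U w + V w)) in B2 *.
have -> : e1 - a * e3 = (e1 - a * e2) - a * (e3 - e2) by ring.
apply: (le_trans (ler_normB _ _)); rewrite normrM (ger0_norm a0).
apply: (le_trans (lerD B1 (ler_wpM2l a0 B2))).
by rewrite le_eqVlt; apply/orP; left; apply/eqP; ring.
Qed.

End stein_pair.

(** * The Stein equation *)

Section stein_solution.
Context {R : realType}.
Notation mu := (@lebesgue_measure R).
Notation phi := (@normal_pdf R 0 1).
Implicit Types (x y : R).

(** Compactness of the segment in its near-covering form, with the radius [a] running along the
    filter of small positive numbers. Only [x] is confined to the segment; [y] may leave it. *)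
Lemma near_uniform_continuous (f : R -> R) (K e : R) : continuous f -> 0 < e ->
  exists2 a : R, 0 < a &
    forall x y, `|x| <= K -> `|y - x| <= a -> `|f y - f x| <= e.
Proof.
move=> cf e0.
have cK : compact `[- K, K] by exact: segment_compact.
have /compact_near_coveringP/(_ R (0^'+)
  (fun a x => forall y, `|y - x| <= a -> `|f y - f x| <= e)) := cK.
case.
  move=> x _.
  have e20 : 0 < e / 2 by rewrite divr_gt0.
  have /cvgrPdist_le/(_ _ e20)/nbhs_ballP[r /= r0 fr] := cf x.
  have r20 : 0 < r / 2 by rewrite divr_gt0.
  exists (ball x (r / 2), [set a | a < r / 2]) => /=.
    split; first exact: nbhsx_ballx.
    exact: nbhs_right_lt.
  move=> [x' a] /= [xx' ar] y yx'.
  have h1 : `|f x - f x'| <= e / 2.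
    by apply: fr; apply: le_ball xx'; rewrite ler_pdivrMr// ler_peMr// ?ler1n// ltW.
  have h2 : `|f x - f y| <= e / 2.
    apply: fr; rewrite /ball/= -[x - y](subrKA x').
    rewrite (le_lt_trans (ler_normD _ _))// [ltRHS]splitr ltr_leD//.
    by rewrite distrC (le_trans yx')// ltW.
  have -> : f y - f x' = (f x - f x') - (f x - f y) by ring.
  by rewrite (le_trans (ler_normB _ _))// [leRHS]splitr lerD.
move=> r /= r0 H; exists (r / 2); first by rewrite divr_gt0.
move=> x y xK; apply: (H (r / 2)) => /=.
- by rewrite sub0r normrN gtr0_norm ?divr_gt0// ltr_pdivrMr// ltr_pMr// ltr1n.
- by rewrite divr_gt0.
- by rewrite in_itv/= -ler_norml.
Qed.

Lemma phiE x : phi x = normal_peak 1 * expR (- (2^-1 * x ^+ 2)).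
Proof.
rewrite normal_pdfE// /normal_fun subr0 expr1n; congr (_ * expR _).
by rewrite mulNr mulrC -[2]natr1.
Qed.

Lemma phi_gt0 x : 0 < phi x.
Proof. by rewrite phiE mulr_gt0 ?expR_gt0 ?normal_peak_gt0. Qed.

Let phiF : phi = (fun x => normal_peak 1 * expR (- (2^-1 * x ^+ 2))).
Proof. by apply/funext => x; exact: phiE. Qed.

Lemma is_derive_phi x : is_derive x 1 phi (- (x * phi x)).
Proof.
have h : is_derive x 1 (fun y : R => - (2^-1 * y ^+ 2)) (- x).
  by apply: is_derive_eq; rewrite /GRing.scale/=; field.
rewrite [X in is_derive _ _ X]phiF.
apply: (is_derive_eq (is_deriveZ (normal_peak 1) (is_derive1_comp (is_derive_expR _) h))).
by rewrite /GRing.scale/= phiE; ring.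
Qed.

Lemma cvg_phi : phi x @[x --> +oo] --> (0 : R).
Proof.
rewrite phiF -[X in _ --> X](mulr0 (normal_peak 1)).
apply: cvgM; first exact: cvg_cst.
apply: (cvg_comp (fun x : R => 2^-1 * x ^+ 2) (fun x => expR (- x))); last exact: cvgr_expR.
by apply: gt0_cvgMry; [rewrite invr_gt0|exact: cvgr_expr2].
Qed.

Lemma phi_even x : phi (- x) = phi x.
Proof. by rewrite !phiE sqrrN. Qed.

Let mphi : measurable_fun setT phi.
Proof. exact: measurable_normal_pdf. Qed.

Lemma integrable_phi (D : set R) : measurable D -> mu.-integrable D (EFin \o phi).
Proof. by move=> mD; apply: integrableS (integrable_normal_pdf 0 1). Qed.

Lemma Rintegral_phi : (\int[mu]_x phi x = 1)%R.
Proof. by rewrite /Rintegral integral_normal_pdf. Qed.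

Lemma integral_xphi x : 0 < x ->
  (\int[mu]_(t in `[x, +oo[) (t * phi t)%:E = (phi x)%:E)%E.
Proof.
move=> x0.
have d y : is_derive y 1 (fun y => - phi y) (y * phi y).
  by apply: (is_derive_eq (is_deriveN (is_derive_phi y))); rewrite opprK.
rewrite (@ge0_continuous_FTC2y _ _ (fun y => - phi y) _ (- 0)).
- by rewrite oppr0 EFinN oppeK add0e.
- by move=> t xt; rewrite mulr_ge0 ?normal_pdf_ge0// (le_trans (ltW x0)).
- apply: continuous_subspaceT => t; apply: cvgM; first exact: cvg_id.
  exact: continuous_normal_pdf.
- by apply: cvgN; exact: cvg_phi.
- by move=> t _; case: (d t).
- by apply: cvgN; apply: cvg_at_right_filter; exact: continuous_normal_pdf.
- by move=> t _; rewrite derive1E; case: (d t).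
Qed.

(** Mills ratio bound: [x <= t] on the domain, and [t * phi t] integrates exactly to [phi x] because
    [- phi] is its antiderivative. *)
Lemma mills x : 0 < x ->
  (x%:E * \int[mu]_(t in `[x, +oo[) (phi t)%:E <= (phi x)%:E)%E.
Proof.
move=> x0; rewrite -integral_xphi// -ge0_integralZl//.
- apply: ge0_le_integral => //.
  + by move=> t _; rewrite -EFinM lee_fin mulr_ge0 ?normal_pdf_ge0// ltW.
  + by apply/measurable_EFinP; apply: measurable_funTS; exact: measurable_funM.
  + by apply/measurable_EFinP; apply: measurable_funTS; exact: measurable_funM.
  + move=> t /=; rewrite in_itv/= andbT => xt.
    by rewrite -EFinM lee_fin ler_wpM2r// normal_pdf_ge0.
- by apply/measurable_EFinP; exact: measurable_funTS.
- by move=> t _; rewrite lee_fin normal_pdf_ge0.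
- by rewrite lee_fin ltW.
Qed.

Lemma mills_left x : x < 0 ->
  ((- x)%:E * \int[mu]_(t in `]-oo, x]) (phi t)%:E <= (phi x)%:E)%E.
Proof.
move=> x0; rewrite -[X in `]-oo, X]]opprK ge0_integration_by_substitutionNy.
- under eq_integral do rewrite /= phi_even.
  by rewrite -(phi_even x); apply: mills; rewrite oppr_gt0.
- by apply: continuous_subspaceT => t; exact: continuous_normal_pdf.
- by move=> t _; exact: normal_pdf_ge0.
Qed.

Section solution.
Variable h : R -> R.
Hypotheses (ch : continuous h) (h01 : forall x, 0 <= h x <= 1).

(* stein_sol solves f' x - x f x = h x - gauss_mean, with f' = stein_der. *)
Definition gauss_mean := \int[mu]_x (h x * phi x).
Let g x := h x - gauss_mean.
Definition stein_num x := \int[mu]_(t in `]-oo, x]) (g t * phi t).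
Definition stein_sol x := stein_num x / phi x.
Definition stein_der x := x * stein_sol x + (h x - gauss_mean).

Let mh : measurable_fun setT h.
Proof. exact: continuous_measurable_fun. Qed.

Let ihphi : mu.-integrable setT (EFin \o (fun t => h t * phi t)).
Proof.
apply: (le_integrable measurableT _ _ (integrable_phi measurableT)).
  by apply/measurable_EFinP; exact: measurable_funM.
move=> t _ /=; rewrite lee_fin normrM.
have /andP[? ?] := h01 t; by rewrite (ger0_norm (x:=h t))// ler_piMl.
Qed.

Lemma gauss_mean01 : 0 <= gauss_mean <= 1.
Proof.
rewrite /gauss_mean; apply/andP; split.
  by apply: Rintegral_ge0 => t _; rewrite mulr_ge0 ?normal_pdf_ge0//; case/andP: (h01 t).
rewrite -[leRHS]Rintegral_phi; apply: le_Rintegral => //; first exact: integrable_phi.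
by move=> t _; have /andP[? ?] := h01 t; rewrite ler_piMl ?normal_pdf_ge0.
Qed.

Let g1 t : `|g t| <= 1.
Proof.
have /andP[? ?] := h01 t; have /andP[? ?] := gauss_mean01.
by rewrite /g ler_norml; lra.
Qed.

Let igphi (D : set R) : measurable D ->
  mu.-integrable D (EFin \o (fun t => g t * phi t)).
Proof.
move=> mD; apply: (@le_integrable _ _ _ mu D mD _ (EFin \o phi)); last exact: integrable_phi.
  apply/measurable_EFinP; apply: measurable_funTS; apply: measurable_funM => //.
  by apply: measurable_funB => //.
move=> t _ /=; rewrite lee_fin normrM (ger0_norm (normal_pdf_ge0 _ _ t)).
by rewrite ler_piMl ?normal_pdf_ge0.
Qed.

Let Rint_gphi_le (D : set R) : measurable D ->
  `|\int[mu]_(t in D) (g t * phi t)| <= \int[mu]_(t in D) phi t.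
Proof.
move=> mD; apply: (le_trans (@le_normr_Rintegral _ _ _ mu D _ mD (igphi mD))).
apply: le_Rintegral => //; [|exact: integrable_phi|].
  exact: integrable_norm (igphi mD).
by move=> t _; rewrite normrM (ger0_norm (normal_pdf_ge0 _ _ t)) ler_piMl ?normal_pdf_ge0.
Qed.

Let total0 : \int[mu]_t (g t * phi t) = 0.
Proof.
under eq_Rintegral do rewrite mulrBl.
rewrite RintegralB// ?RintegralZl// ?Rintegral_phi ?mulr1 ?subrr//.
- exact: integrable_phi.
- exact: (@integrableZl _ _ _ mu setT measurableT gauss_mean (EFin \o phi) (integrable_phi measurableT)).
Qed.

Let fine_phi (D : set R) : measurable D ->
  (\int[mu]_(t in D) (phi t)%:E)%E = (\int[mu]_(t in D) phi t)%:E.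
Proof. by move=> mD; rewrite fineK// integrable_fin_num//; exact: integrable_phi. Qed.

(** For negative [x] this is the left Mills bound. For positive [x] the centred integrand has total
    integral 0, so the left integral is minus the right tail, where Mills applies again. *)
Lemma stein_num_tail x : `|x| * `|stein_num x| <= phi x.
Proof.
have [x0|x0|->] := ltrgtP x 0; last by rewrite normr0 mul0r normal_pdf_ge0.
  have mI : measurable `]-oo, x] by exact: measurable_itv.
  have := mills_left x0; rewrite fine_phi// -EFinM lee_fin; apply: le_trans.
  by rewrite (ltr0_norm x0) ler_wpM2l ?oppr_ge0 ?(ltW x0)//; exact: Rint_gphi_le.
have mI : measurable `[x, +oo[ by exact: measurable_itv.
have mJ : measurable `]x, +oo[ by exact: measurable_itv.
have := mills x0; rewrite fine_phi// -EFinM lee_fin; apply: le_trans.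
rewrite (gtr0_norm x0) ler_wpM2l ?(ltW x0)//.
have : stein_num x + \int[mu]_(t in `]x, +oo[) (g t * phi t) = 0.
  rewrite -[RHS]total0 /stein_num -(@Rintegral_setU _ _ _ mu)//=.
  - by congr Rintegral; rewrite -itv_bndbnd_setU// set_itvE.
  - by rewrite -itv_bndbnd_setU//; exact: igphi.
  - by apply/disj_setPS => t /=; rewrite !in_itv/= andbT => -[? ?]; lra.
move=> /eqP; rewrite addr_eq0 => /eqP ->; rewrite normrN.
by rewrite Rintegral_itv_obnd_cbnd; [exact: Rint_gphi_le|exact: igphi].
Qed.

Lemma stein_num_le1 x : `|stein_num x| <= 1.
Proof.
have mI : measurable `]-oo, x] by exact: measurable_itv.
apply: (le_trans (Rint_gphi_le mI)); rewrite -[leRHS]Rintegral_phi -lee_fin -!fine_phi//.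
apply: ge0_subset_integral => //; first exact/measurable_EFinP.
by move=> t _; rewrite lee_fin normal_pdf_ge0.
Qed.

(** Quotient rule: the numerator has derivative [g x * phi x], and [phi' = - x phi] turns the
    derivative of [1 / phi] into the term [x * stein_sol x]. *)
Lemma is_derive_stein_sol x : is_derive x 1 stein_sol (stein_der x).
Proof.
have cgphi : continuous (fun t => g t * phi t).
  move=> t; apply: cvgM; last exact: continuous_normal_pdf.
  by apply: cvgB; [exact: ch|exact: cvg_cst].
have [] := @continuous_FTC1 R (fun t => g t * phi t) -oo%O x (x + 1).
- by rewrite ltrDl.
- by apply: igphi; exact: measurable_itv.
- by rewrite ltNyr.
- exact: cgphi.
rewrite derive1E => dG GE.
have dn : is_derive x 1 stein_num (g x * phi x) by split.
have p0 : phi x != 0 by rewrite gt_eqF ?phi_gt0.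
have dV := is_deriveV p0 (is_derive_phi x).
apply: (is_derive_eq (is_deriveM dn dV)).
by rewrite /GRing.scale/= /stein_der /stein_sol /g; field.
Qed.

Lemma stein_xsol x : `|x * stein_sol x| <= 1.
Proof.
rewrite mulrA normrM normfV (gtr0_norm (phi_gt0 x)) ler_pdivrMr ?phi_gt0// mul1r.
by rewrite normrM stein_num_tail.
Qed.

(** For [|x| >= 1] the bound on [x * stein_sol x] suffices; for [|x| < 1] the numerator is at most 1
    and [phi x >= phi 1]. The constant adds the two cases. *)
Lemma stein_sol_bounded x : `|stein_sol x| <= 1 + (phi 1)^-1.
Proof.
have p1 := phi_gt0 1; have px := phi_gt0 x.
have [x1|x1] := leP 1 `|x|.
  apply: (@le_trans _ _ 1); last by rewrite lerDl invr_ge0 ltW.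
  by have := stein_xsol x; rewrite normrM; apply: le_trans; rewrite ler_peMl.
apply: (@le_trans _ _ (phi 1)^-1); last by rewrite lerDr.
rewrite normrM normfV (gtr0_norm px).
apply: (@le_trans _ _ (phi x)^-1).
  by rewrite ler_piMl ?stein_num_le1// invr_ge0 ltW.
rewrite lef_pV2 ?posrE// !phiE ler_wpM2l ?normal_peak_ge0// ler_expR lerN2.
rewrite ler_wpM2l ?invr_ge0// -[leLHS]real_normK ?num_real// expr1n.
by rewrite expr_le1// ltW.
Qed.

Lemma stein_der_bounded x : `|stein_der x| <= 2.
Proof.
rewrite (le_trans (ler_normD _ _))// -[2]/(1 + 1 : R) lerD ?stein_xsol//; exact: g1.
Qed.

Lemma continuous_stein_der : continuous stein_der.
Proof.
move=> x; apply: cvgD; last by apply: cvgB; [exact: ch|exact: cvg_cst].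
apply: cvgM; first exact: cvg_id.
apply/differentiable_continuous/derivable1_diffP.
by case: (is_derive_stein_sol x).
Qed.

(** Three regimes, one per term: uniform continuity for [x] in a compact set, the quadratic term for
    [x] outside it, and the crude bound 4 for large increments. *)
Lemma stein_der_modulus e : 0 < e -> exists2 a : R, 0 < a &
  forall x y, `|stein_der y - stein_der x| <=
    e + e * x ^+ 2 + 4 * (a < `|y - x|)%R%:R.
Proof.
(* Then [e * K ^+ 2 = e + 8 + 16 / e], so beyond [K] the quadratic term exceeds 4. *)
move=> e0; pose K := 1 + 4 / e.
have K0 : 0 < K by rewrite addr_gt0// divr_gt0.
have [a a0 aP] := near_uniform_continuous K continuous_stein_der e0.
exists a => // x y.
have ex : 0 <= e * x ^+ 2 by rewrite mulr_ge0 ?sqr_ge0// ltW.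
have le4 : `|stein_der y - stein_der x| <= 4.
  rewrite (le_trans (ler_normB _ _))// (_ : 4 = 2 + 2) ?lerD ?stein_der_bounded//.
  by rewrite -natrD.
case: ltP => [_|ya] /=; first by rewrite mulr1; lra.
rewrite mulr0 addr0; have [xK|xK] := leP `|x| K.
  by rewrite (le_trans (aP _ _ xK ya))//; lra.
apply: (le_trans le4); apply: (@le_trans _ _ (e * x ^+ 2)); last by lra.
rewrite -[x ^+ 2]real_normK ?num_real//.
have : K ^+ 2 <= `|x| ^+ 2 by apply: lerXn2r; rewrite ?nnegrE ?normr_ge0// ltW.
move/(ler_wpM2l (ltW e0)); apply: le_trans.
rewrite (_ : e * K ^+ 2 = e + 8 + 16 / e); last by rewrite /K; field; rewrite gt_eqF.
have : 0 < 16 / e by rewrite divr_gt0.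
lra.
Qed.

Lemma stein_eq x : stein_der x - x * stein_sol x = h x - gauss_mean.
Proof. by rewrite /stein_der; ring. Qed.

End solution.
End stein_solution.

(** * The Lindeberg central limit theorem *)

Section lindeberg.
Context {d} {T : measurableType d} {R : realType} (P : probability T R).
Context {I : eqType}.
Notation mu := (@lebesgue_measure R).
Notation phi := (@normal_pdf R 0 1).

Record lindeberg_array (Y : I -> T -> R) (J : seq I) : Prop := {
  la_meas : forall i, measurable_fun setT (Y i) ;
  la_indep : mutually_independent P Y ;
  la_sqr : forall i, Lone P (fun w => Y i w ^+ 2) ;
  la_mean : forall i, Ex P (Y i) = 0 ;
  la_uniq : uniq J ;
  la_var : \sum_(i <- J) Ex P (fun w => Y i w ^+ 2) = 1 }.

(** [delta] and [t] are chosen before the array, so one pair serves the estimators for all [eps],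
    whatever their index lists. *)
Lemma lindeberg_continuous (h : R -> R) (e : R) : continuous h ->
  (forall x, 0 <= h x <= 1) -> 0 < e ->
  exists delta t : R, [/\ 0 < delta, 0 < t &
    forall Y J, lindeberg_array Y J ->
      \sum_(i <- J) Ex P (trunc_sqr delta (Y i)) <= t ->
      `|Ex P (fun w => h (\sum_(i <- J) Y i w)) - gauss_mean h| <= e].
Proof.
move=> ch h01 e0; pose e1 := e / 8.
have e10 : 0 < e1 by rewrite divr_gt0.
have [delta delta0 mod] := stein_der_modulus ch h01 e10.
(* Each individual variance is at most 1, so [k] dominates the factor [1 + a / delta ^+ 2] of
   [stein_pair]. The final bound is [4 * e1] from the variances plus [4 * k * t = 4 * e1], which
   makes [e]. *)
pose k := 1 + delta ^- 2.
have k0 : 0 < k by rewrite addr_gt0// invr_gt0 exprn_gt0.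
pose t := e1 / k.
exists delta, t; split=> //; first by rewrite divr_gt0.
move=> Y J [mY iY LY EY uJ VJ] tJ.
pose f := stein_sol h; pose f' := stein_der h.
have cf' : continuous f' by exact: continuous_stein_der.
have mf' : measurable_fun setT f' by exact: continuous_measurable_fun.
pose S w := \sum_(i <- J) Y i w.
have mS : measurable_fun setT S by exact: measurable_sum.
have a0 i : 0 <= Ex P (fun w => Y i w ^+ 2) by apply: Ex_ge0 => w; exact: sqr_ge0.
have tau0 i : 0 <= Ex P (trunc_sqr delta (Y i)).
  by apply: Ex_ge0 => w; exact: trunc_sqr_ge0.
have step j : j \in J ->
    Lone P (fun w => Y j w * f (S w)) /\
    `|Ex P (fun w => Y j w * f (S w)) -
      Ex P (fun w => Y j w ^+ 2) * Ex P (fun w => f' (S w))| <=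
    4 * e1 * Ex P (fun w => Y j w ^+ 2) + 4 * k * Ex P (trunc_sqr delta (Y j)).
  move=> jJ; pose V w := \sum_(i <- rem j J) Y i w.
  have SE : S = (fun w => Y j w + V w).
    by apply/funext => w; rewrite /S (big_rem j).
  have mV : measurable_fun setT V by exact: measurable_sum.
  have ur : uniq (j :: rem j J) by rewrite -(perm_uniq (perm_to_rem jJ)).
  have [LV EV] := Ex_sqr_sum mY iY LY EY (rem_uniq j uJ).
  have aV : Ex P (fun w => Y j w ^+ 2) + Ex P (fun w => V w ^+ 2) = 1.
    by rewrite EV -VJ [in RHS](big_rem j).
  have [] := stein_pair (@is_derive_stein_sol _ _ ch h01) mf'
    (@stein_sol_bounded _ _ ch h01) (@stein_der_bounded _ _ ch h01)
    (ler0n R 4) delta0 mod (mY j) mV (indep2_sum mY iY ur) (LY j) LV (EY j).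
  rewrite SE => L1 B1; split=> //.
  apply: (le_trans B1).
  have := a0 j; have := tau0 j.
  have : 0 <= Ex P (fun w => V w ^+ 2) by apply: Ex_ge0 => w; exact: sqr_ge0.
  move: aV; set a := Ex P (fun w => Y j w ^+ 2); set v := Ex P (fun w => V w ^+ 2).
  set u := Ex P (trunc_sqr _ _) => av v0 u0 aj0.
  have d2 : 0 < delta ^- 2 by rewrite invr_gt0 exprn_gt0.
  apply: lerD.
    rewrite (_ : 4 * e1 * a = 2 * a * (e1 + e1)); last by ring.
    apply: ler_wpM2l; first by rewrite mulr_ge0.
    by rewrite lerD2l ler_piMr ?(ltW e10)//; lra.
  rewrite (_ : 4 * k * u = 4 * u * k); last by ring.
  apply: ler_wpM2l; first by rewrite mulr_ge0.
  by rewrite lerD2l ler_piMl ?(ltW d2)//; lra.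
have LYf j : j \in J -> Lone P (fun w => Y j w * f (S w)) by move=> /step[].
have Lf' : Lone P (fun w => f' (S w)).
  apply: (Lone_le _ (Lone_cst P 2)); first exact: (measurableT_comp mf' mS).
  by move=> w; exact: stein_der_bounded.
have mh : measurable_fun setT h by exact: continuous_measurable_fun.
have Lh : Lone P (fun w => h (S w)).
  apply: (Lone_le _ (Lone_cst P 1)); first exact: (measurableT_comp mh mS).
  by move=> w; have /andP[? ?] := h01 (S w); rewrite ger0_norm.
(* The Stein equation at [S], with the factor [S] split into its summands and the coefficient 1 of
   [f'] split into their variances. *)
have E1 : Ex P (fun w => h (S w)) - gauss_mean h =
    \sum_(j <- J) (Ex P (fun w => Y j w ^+ 2) * Ex P (fun w => f' (S w)) -
                   Ex P (fun w => Y j w * f (S w))).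
  rewrite sumrB -mulr_suml VJ mul1r -Ex_sum// -ExB//; last exact: Lone_sum.
  rewrite -[X in _ - X](Ex_cst P) -ExB//; last exact: Lone_cst.
  by congr Ex; apply/funext => w; rewrite -mulr_suml -stein_eq.
rewrite -/S E1 (le_trans (ler_norm_sum _ _ _))//.
apply: (@le_trans _ _ (\sum_(j <- J) (4 * e1 * Ex P (fun w => Y j w ^+ 2) +
    4 * k * Ex P (trunc_sqr delta (Y j))))).
  rewrite big_seq [leRHS]big_seq; apply: ler_sum => j /step[_].
  by rewrite distrC.
rewrite big_split/= -!mulr_sumr VJ.
apply: (@le_trans _ _ (4 * e1 * 1 + 4 * k * t)).
  by rewrite lerD2l ler_wpM2l// mulr_ge0// ltW.
rewrite (_ : 4 * k * t = 4 * e1); last by rewrite /t; field; rewrite gt_eqF.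
by rewrite /e1; lra.
Qed.

(** For [s > 0], the piecewise linear cutoff equal to 1 up to [a] and to 0 from [a + s] on. *)
Definition ramp (a s x : R) : R := Num.min 1 (Num.max 0 ((a + s - x) / s)).

Lemma ramp01 a s x : 0 <= ramp a s x <= 1.
Proof. by rewrite /ramp le_min ler01 le_max lexx/= ge_min lexx. Qed.

Lemma ramp_continuous a s : continuous (ramp a s).
Proof.
move=> x.
apply: (@continuous_min _ _ (cst 1) (fun x => Num.max 0 ((a + s - x) / s)) x); first exact: cvg_cst.
apply: (@continuous_max _ _ (cst 0) (fun x => (a + s - x) / s) x); first exact: cvg_cst.
apply: cvgM; last exact: cvg_cst.
by apply: cvgB; [exact: cvg_cst|exact: cvg_id].
Qed.

Lemma ramp_ge a s x : 0 < s -> (x <= a)%R%:R <= ramp a s x.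
Proof.
move=> s0; case: (leP x a) => xa /=; last by case/andP: (ramp01 a s x).
rewrite /ramp le_min lexx/= le_max; apply/orP; right.
by rewrite ler_pdivlMr// mul1r; lra.
Qed.

Lemma ramp_le a s x : 0 < s -> ramp a s x <= (x <= a + s)%R%:R.
Proof.
move=> s0; case: (leP x (a + s)) => xa /=; first by case/andP: (ramp01 a s x).
rewrite /ramp ge_min; apply/orP; right; rewrite ge_max lexx/=.
by rewrite ler_pdivrMr// mul0r; lra.
Qed.

Let Phi (x : R) := \int[mu]_(t in `]-oo, x]) phi t.

Lemma normal_probE (x : R) : normal_prob 0 1 `]-oo, x] = (Phi x)%:E.
Proof.
by rewrite /normal_prob fineK// integrable_fin_num//; exact: integrable_phi.
Qed.

Lemma Phi_shift (x s : R) : 0 <= s -> Phi (x + s) <= Phi x + normal_peak 1 * s.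
Proof.
move=> s0.
have mA : measurable `]-oo, x] by exact: measurable_itv.
have mB : measurable `]x, x + s] by exact: measurable_itv.
have -> : Phi (x + s) = Phi x + \int[mu]_(t in `]x, x + s]) phi t.
  rewrite /Phi -(@Rintegral_setU _ _ _ mu)//=.
  - by congr Rintegral; rewrite -itv_bndbnd_setU// bnd_simp lerDl.
  - by apply: integrable_phi; exact: measurableU.
  - by apply/disj_setPS => t /=; rewrite !in_itv/= => -[? /andP[? ?]]; lra.
rewrite lerD2l.
have -> : normal_peak 1 * s = \int[mu]_(t in `]x, x + s]) (normal_peak 1).
  rewrite (@Rintegral_cst _ _ _ mu)//=; congr (_ * _).
  rewrite lebesgue_measure_itv/= lte_fin ltrDl; case: ltP => h /=; first by rewrite addrC addKr.
  by apply/eqP; rewrite eq_le h s0.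
apply: (@le_Rintegral _ _ _ mu) => //.
- exact: integrable_phi.
- apply: (@measurable_bounded_integrable _ _ _ mu) => //.
    rewrite /= lebesgue_measure_itv/=; case: ifP => _; by rewrite -?EFinD ltry.
  exact: bounded_cst.
- by move=> t _; exact: normal_pdf_ub.
Qed.

Let ramp_phi a s : mu.-integrable setT (EFin \o (fun t => ramp a s t * phi t)).
Proof.
apply: (@le_integrable _ _ _ mu setT measurableT _ (EFin \o phi)); last exact: integrable_phi.
  apply/measurable_EFinP; apply: measurable_funM; last exact: measurable_normal_pdf.
  by apply: continuous_measurable_fun; exact: ramp_continuous.
move=> t _ /=; have /andP[? ?] := ramp01 a s t.
by rewrite lee_fin normrM ger0_norm// ler_piMl.
Qed.

Let PhiE x : Phi x = \int[mu]_t ((t <= x)%R%:R * phi t).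
Proof.
rewrite /Phi Rintegral_mkcond; apply: eq_Rintegral => t _.
by rewrite patchE mem_setE in_itv/=; case: ifP => _; rewrite ?mul1r ?mul0r.
Qed.

Let ind_phi x : mu.-integrable setT (EFin \o (fun t => (t <= x)%R%:R * phi t)).
Proof.
have -> : (fun t => (t <= x)%R%:R * phi t) = (phi \_ `]-oo, x]).
  apply/funext => t.
  by rewrite patchE mem_setE in_itv/=; case: ifP => _; rewrite ?mul1r ?mul0r.
rewrite -restrict_EFin; apply: (iffLR (@integrable_mkcond _ _ _ mu `]-oo, x] _ _)) => //.
by apply: integrable_phi.
Qed.

Lemma gauss_mean_ramp_le a s : 0 < s -> gauss_mean (ramp a s) <= Phi (a + s).
Proof.
move=> s0; rewrite PhiE; apply: (@le_Rintegral _ _ _ mu) => //.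
by move=> t _; rewrite ler_wpM2r ?normal_pdf_ge0// ramp_le.
Qed.

Lemma gauss_mean_ramp_ge a s : 0 < s -> Phi a <= gauss_mean (ramp a s).
Proof.
move=> s0; rewrite PhiE; apply: (@le_Rintegral _ _ _ mu) => //.
by move=> t _; rewrite ler_wpM2r ?normal_pdf_ge0// ramp_ge.
Qed.

Lemma Ex_indic_le (S : T -> R) (x : R) : measurable_fun setT S ->
  Lone P (fun w => (S w <= x)%R%:R) /\
  Ex P (fun w => (S w <= x)%R%:R) = fine (P [set w | S w <= x]).
Proof.
move=> mS.
have mA : measurable [set w | S w <= x].
  rewrite (_ : [set w | _] = S @^-1` `]-oo, x]); first exact: measurable_preimage.
  by apply/seteqP; split => w /=; rewrite in_itv.
have E : (fun w => (S w <= x)%R%:R) = \1_[set w | S w <= x] :> (T -> R).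
  by apply/funext => w; rewrite indicE mem_setE.
rewrite E; split; last by rewrite /Ex /Rintegral integral_indic// setIT.
apply: (Lone_le _ (Lone_cst P 1)); first exact: measurable_indic.
by move=> w; rewrite indicE; case: (_ \in _); rewrite /= ?normr1// normr0.
Qed.

Theorem lindeberg_cdf (x e : R) : 0 < e ->
  exists delta t : R, [/\ 0 < delta, 0 < t &
    forall Y J, lindeberg_array Y J ->
      \sum_(i <- J) Ex P (trunc_sqr delta (Y i)) <= t ->
      `|fine (P [set w | \sum_(i <- J) Y i w <= x]) -
        fine (normal_prob 0 1 `]-oo, x])| <= e].
Proof.
move=> e0; rewrite normal_probE/=.
have pk : 0 < normal_peak 1 :> R by exact: normal_peak_gt0.
(* A window of length [s] has Gaussian mass at most [e / 2]; the other half of [e] goes to the two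
   ramp expectations. *)
pose s := e / 2 / normal_peak 1.
have s0 : 0 < s by rewrite !divr_gt0.
have e20 : 0 < e / 2 by rewrite divr_gt0.
have ps : normal_peak 1 * s = e / 2 by rewrite /s mulrC divfK// gt_eqF.
have [d1 [t1 [d10 t10 H1]]] :=
  lindeberg_continuous (@ramp_continuous x s) (ramp01 x s) e20.
have [d2 [t2 [d20 t20 H2]]] :=
  lindeberg_continuous (@ramp_continuous (x - s) s) (ramp01 (x - s) s) e20.
exists (Num.min d1 d2), (Num.min t1 t2); split.
- by rewrite lt_min d10.
- by rewrite lt_min t10.
move=> Y J A tJ; have [mY _ LY _ _ _] := A.
pose S w := \sum_(i <- J) Y i w.
have mS : measurable_fun setT S by exact: measurable_sum.
(* Truncated moments decrease in the threshold, so the smaller of [d1] and [d2] controls both. *)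
have mono (d' : R) : Num.min d1 d2 <= d' ->
    \sum_(i <- J) Ex P (trunc_sqr d' (Y i)) <= Num.min t1 t2.
  move=> dd; apply: le_trans tJ; apply: ler_sum => i _.
  apply: Ex_le; [exact: Lone_trunc_sqr|exact: Lone_trunc_sqr|] => w.
  rewrite /trunc_sqr; case: ifP => h1; case: ifP => h2 //; last exact: sqr_ge0.
  by move: h2; rewrite (le_lt_trans dd h1).
have Lr a s' : Lone P (fun w => ramp a s' (S w)).
  apply: (Lone_le _ (Lone_cst P 1)).
    apply: (measurableT_comp _ mS); apply: continuous_measurable_fun.
    exact: ramp_continuous.
  by move=> w; have /andP[? ?] := ramp01 a s' (S w); rewrite ger0_norm.
have [Lx <-] := Ex_indic_le x mS.
have {}H1 : `|Ex P (fun w => ramp x s (S w)) - gauss_mean (ramp x s)| <= e / 2.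
  apply: H1 => //; apply: (le_trans (mono _ _)); rewrite ge_min lexx//.
have {}H2 : `|Ex P (fun w => ramp (x - s) s (S w)) - gauss_mean (ramp (x - s) s)| <= e / 2.
  apply: H2 => //; apply: (le_trans (mono _ _)); rewrite ge_min lexx ?orbT//.
have B1 : Ex P (fun w => (S w <= x)%R%:R) <= Ex P (fun w => ramp x s (S w)).
  by apply: Ex_le => // w; exact: ramp_ge.
have B2 : Ex P (fun w => ramp (x - s) s (S w)) <= Ex P (fun w => (S w <= x)%R%:R).
  by apply: Ex_le => // w; have := ramp_le (x - s) (S w) s0; rewrite subrK.
have C1 := gauss_mean_ramp_le x s0.
have C2 := gauss_mean_ramp_ge (x - s) s0.
have D1 := Phi_shift x (ltW s0).
have D2 := Phi_shift (x - s) (ltW s0).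
rewrite subrK in D2; rewrite ps in D1 D2.
move: H1 H2; rewrite !ler_norml => /andP[? ?] /andP[? ?].
apply/andP; split; lra.
Qed.

End lindeberg.

(** * Sequences, rounding and laws *)

Section sequences.
Context {R : realType}.
Implicit Types (e q : R).

(** A Toeplitz argument: the levels from [l0] on are small uniformly in [L], and the finitely many
    others have ratios tending to 0 under weights of sum at most 1. *)
Lemma weighted_average_to0 (b : nat -> R) (r : nat -> nat -> R) :
  let S L := \sum_(0 <= l < L.+1) b l in
  (forall l, 0 <= b l) -> 0 < b 0%N -> (forall L l, 0 <= r L l) ->
  (forall l e, 0 < e -> exists N, forall L, (N <= L)%N -> r L l <= e) ->
  (forall e, 0 < e -> exists l0, forall L,
     \sum_(l0 <= l < L.+1) b l / S L * r L l <= e) ->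
  forall e, 0 < e -> exists N, forall L, (N <= L)%N ->
     \sum_(0 <= l < L.+1) b l / S L * r L l <= e.
Proof.
move=> S b0 b00 r0 head tail e e0.
have e20 : 0 < e / 2 by rewrite divr_gt0.
have [l0 Hl0] := tail _ e20.
have SE L k : (k <= L.+1)%N -> \sum_(0 <= l < k) b l <= S L.
  move=> kL; rewrite /S (big_cat_nat (leq0n k) kL)//= lerDl.
  by apply: sumr_ge0 => *; exact: b0.
have S0 L : 0 < S L.
  by apply: (lt_le_trans b00); have := SE L 1%N isT; rewrite big_nat1.
have [N HN] : exists N, forall L l, (N <= L)%N -> (l < l0)%N -> r L l <= e / 2.
  elim: (l0) => [|k [N HN]]; first by exists 0%N.
  have [M HM] := head k _ e20.
  exists (maxn N M) => L l; rewrite geq_max => /andP[NL ML].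
  by rewrite ltnS leq_eqVlt => /predU1P[->|]; [exact: HM|exact: HN].
exists (maxn N l0) => L; rewrite geq_max => /andP[NL lL].
have lL1 : (l0 <= L.+1)%N by exact: leqW.
rewrite (big_cat_nat (leq0n l0) lL1)//= [leRHS]splitr lerD//.
apply: (@le_trans _ _ (\sum_(0 <= l < l0) b l / S L * (e / 2))).
  rewrite big_nat_cond [leRHS]big_nat_cond; apply: ler_sum => l /andP[/andP[_ ll0] _].
  by rewrite ler_wpM2l ?HN// divr_ge0 ?b0// ltW.
rewrite -mulr_suml -mulr_suml ler_piMl ?(ltW e20)//.
by rewrite ler_pdivrMr// mul1r SE.
Qed.

Lemma sum_geometric_tail_le q k n : 0 < q < 1 ->
  \sum_(k <= l < n) q ^+ l <= q ^+ k / (1 - q).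
Proof.
move=> /andP[q0 q1]; rewrite ler_pdivlMr ?subr_gt0//.
have [nk|kn] := leqP n k; first by rewrite big_geq// mul0r exprn_ge0// ltW.
rewrite mulr_suml; under eq_bigr do rewrite mulrBr mulr1 -exprSr.
rewrite (eq_bigr (fun l => - (q ^+ l.+1 - q ^+ l))) => [|l _]; last by rewrite opprB.
by rewrite sumrN telescope_sumr ?(ltnW kn)// opprB gerBl exprn_ge0// ltW.
Qed.

Lemma sum_geometric_le q n : 1 < q ->
  \sum_(0 <= l < n.+1) q ^+ l <= q / (q - 1) * q ^+ n.
Proof.
move=> q1; have q10 : 0 < q - 1 by rewrite subr_gt0.
rewrite mulrAC ler_pdivlMr// mulr_suml.
under eq_bigr do rewrite mulrBr mulr1 -exprSr.
by rewrite telescope_sumr// expr0 -exprS gerBl.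
Qed.

Lemma expr_small q e : 0 < q < 1 -> 0 < e ->
  exists N, forall L, (N <= L)%N -> q ^+ L <= e.
Proof.
move=> /andP[q0 q1] e0.
have /cvg_expr/cvgr0Pnorm_le/(_ _ e0)[N _ HN] : `|q| < 1 by rewrite gtr0_norm.
by exists N => L NL; have := HN _ NL; rewrite /= ger0_norm// exprn_ge0// ltW.
Qed.

(** The lower limit is the supremum of the tail infima, so a number strictly below it lies below one
    of them. *)
Lemma limn_einf_gt (u : nat -> R) (a : R) :
  (a%:E < limn_einf (fun n => (u n)%:E))%E ->
  exists N, forall n, (N <= n)%N -> a < u n.
Proof.
rewrite limn_einf_lim (cvg_lim _ (cvg_einfs_sup (u:=_)))//.
move=> /ereal_sup_gt[_ [N _ <-]] aN; exists N => n Nn.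
rewrite -lte_fin; apply: (lt_le_trans aN).
by apply: ereal_inf_lbound; exists n.
Qed.

Lemma int_to_nat_ceil (a : R) : 0 <= a ->
  a <= (int_to_nat (Num.ceil a))%:R < a + 1.
Proof.
move=> a0; have /andP[c1 c2] := ceil_itv a.
(* This excludes the negative integers, which [int_to_nat] would send to 0. *)
have : 0 <= Num.ceil a by rewrite ceil_ge0 (lt_le_trans _ a0)// ltrN10.
case: (Num.ceil a) c1 c2 => // n; rewrite intrB /= => c1 c2 _.
by rewrite c2/= -ltrBlDr.
Qed.

Lemma maxn1_ceil (a : R) : 0 <= a ->
  a <= (maxn (int_to_nat (Num.ceil a)) 1)%:R <= a + 1.
Proof.
move=> a0; have /andP[c1 /ltW c2] := int_to_nat_ceil a0.
apply/andP; split; first by rewrite (le_trans c1)// ler_nat leq_maxl.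
by rewrite /maxn; case: ifP => // _; rewrite lerDr.
Qed.

(** As [eps <= c], the logarithm is nonnegative, and rounding up together with the maximum with 1
    adds at most 1 to the level, hence the factor [expR alpha]. *)
Lemma Leps_expR_le (alpha c eps : R) : 0 < alpha -> 0 < eps -> eps <= c ->
  eps * expR (alpha * (Leps alpha c eps)%:R) <= c * expR alpha.
Proof.
move=> al0 e0 ec.
have c0 : 0 < c by exact: lt_le_trans ec.
have x0 : 0 <= ln (c / eps) / alpha.
  by rewrite divr_ge0 ?(ltW al0)// ln_ge0// ler_pdivlMr// mul1r.
have /andP[_ L1] := maxn1_ceil x0.
have : alpha * (Leps alpha c eps)%:R <= ln (c / eps) + alpha.
  apply: (le_trans (ler_wpM2l (ltW al0) L1)).
  by rewrite mulrDr mulr1 mulrC divfK// gt_eqF.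
rewrite -ler_expR expRD lnK ?posrE ?divr_gt0// => H.
apply: (le_trans (ler_wpM2l (ltW e0) H)).
by rewrite mulrA mulrCA divff ?mulr1// gt_eqF.
Qed.

Lemma Leps_ge (alpha c eps : R) (N : nat) : 0 < alpha -> 0 < c -> 0 < eps ->
  eps <= c * expR (- (alpha * N%:R)) -> (N <= Leps alpha c eps)%N.
Proof.
move=> al0 c0 e0 ec.
have cN : expR (alpha * N%:R) <= c / eps.
  rewrite ler_pdivlMr// mulrC -ler_pdivlMr ?expR_gt0//.
  by rewrite -expRN.
have aN : alpha * N%:R <= ln (c / eps).
  by rewrite -ler_expR lnK// posrE divr_gt0.
have xN : N%:R <= ln (c / eps) / alpha by rewrite ler_pdivlMr// mulrC.
have /andP[x1 _] := maxn1_ceil (le_trans (ler0n _ _) xN).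
by rewrite -(@ler_nat R) (le_trans xN).
Qed.

End sequences.

(** * Equality in law and vanishing truncated moments *)

Section laws.
Context {d} {T : measurableType d} {R : realType} (P : probability T R).

Lemma mutually_independent_comp (I : eqType) (Y : I -> T -> R) (g : I -> R -> R) :
  (forall i, measurable_fun setT (g i)) ->
  mutually_independent P Y -> mutually_independent P (fun i => g i \o Y i).
Proof.
move=> mg iY J B uJ mB.
apply: (iY J (fun i => g i @^-1` B i) uJ) => j /mB mBj.
by rewrite -[X in measurable X]setTI; exact: mg.
Qed.

Lemma Ex_same_law (U V : T -> R) (F : R -> R) :
  measurable_fun setT U -> measurable_fun setT V -> measurable_fun setT F ->
  (forall B, measurable B -> P (U @^-1` B) = P (V @^-1` B)) ->
  Lone P (fun w => F (V w)) ->
  Lone P (fun w => F (U w)) /\ Ex P (fun w => F (U w)) = Ex P (fun w => F (V w)).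
Proof.
move=> mU mV mF UV LV.
pose X : {RV P >-> R} := HB.pack U (isMeasurableFun.Build _ _ _ _ U mU).
pose Y : {RV P >-> R} := HB.pack V (isMeasurableFun.Build _ _ _ _ V mV).
have mFE : measurable_fun setT (EFin \o F) by exact/measurable_EFinP.
have LU : Lone P (fun w => F (U w)).
  apply/integrableP; split.
    by apply/measurable_EFinP; exact: (measurableT_comp mF mU).
  move/integrableP : LV => [_].
  have mnF : measurable_fun setT (abse \o (EFin \o F)) by exact: measurableT_comp.
  have nn y : (0 <= (abse \o (EFin \o F)) y)%E by exact: abse_ge0.
  rewrite -(@ge0_integral_distribution _ _ _ _ _ P Y (abse \o (EFin \o F)))//.
  rewrite -(@ge0_integral_distribution _ _ _ _ _ P X (abse \o (EFin \o F)))//.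
  rewrite (@eq_measure_integral _ _ _ setT (distribution P X))//.
  by move=> B mB _; exact/esym/UV.
split=> //; rewrite /Ex /Rintegral; congr fine.
transitivity (\int[distribution P X]_x (F x)%:E)%E.
  by rewrite integral_pushforward.
rewrite (@eq_measure_integral _ _ _ setT (distribution P Y))//.
  by rewrite integral_pushforward.
by move=> B mB _; exact: UV.
Qed.

(** Dominated convergence along integer thresholds, with majorant [U ^+ 2]; monotonicity extends it
    to real thresholds. *)
Lemma trunc_sqr_cvg0 (U : T -> R) (e : R) : measurable_fun setT U ->
  Lone P (fun w => U w ^+ 2) -> 0 < e ->
  exists A : R, forall a, A <= a -> Ex P (trunc_sqr a U) <= e.
Proof.
move=> mU LU e0.
have [] := @dominated_convergence _ T R P setT measurableT
  (fun n w => (trunc_sqr n%:R U w)%:E) (cst 0%E) (fun w => (U w ^+ 2)%:E).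
- by move=> n; apply/measurable_EFinP; exact: measurable_trunc_sqr.
- exact: measurable_cst.
- apply: aeW => w _; apply: cvg_near_cst.
  near=> n; rewrite /trunc_sqr ifN// -leNgt.
  by near: n; exact: nbhs_infty_ger.
- exact: LU.
- apply: aeW => w n _; rewrite /trunc_sqr; case: ifP => _ /=.
    by rewrite lee_fin ger0_norm// sqr_ge0.
  by rewrite normr0 lee_fin sqr_ge0.
move=> _ _; rewrite integral0 => /fine_cvgP[_ /cvgr0Pnorm_le/(_ _ e0)[N _ HN]].
exists N%:R => a Na.
apply: (@le_trans _ _ (Ex P (trunc_sqr N%:R U))).
  apply: Ex_le; [exact: Lone_trunc_sqr|exact: Lone_trunc_sqr|] => w.
  rewrite /trunc_sqr; case: ifP => h1; case: ifP => h2 //; last exact: sqr_ge0.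
  by move: h2; rewrite (le_lt_trans Na h1).
by apply: (le_trans (ler_norm _)); exact: (HN N (leqnn N)).
Unshelve. all: by end_near. Qed.

End laws.

(** * The normalised multilevel estimator *)

Section multilevel_estimator.
Context {d} {T : measurableType d} {R : realType} (P : probability T R).
Variables (Xs : nat -> T -> R) (Y : nat -> nat -> T -> R).
Hypothesis hXs : forall l, Xs l \in Lfun P 2%:E.
Hypothesis hYm : forall l i, measurable_fun setT (Y l i).
Hypothesis hYind : mutually_independent P (fun li : nat * nat => Y li.1 li.2).
Hypothesis hYlaw : forall l i (B : set R), measurable B ->
  P (Y l i @^-1` B) = P (DeltaX Xs l @^-1` B).

Lemma fine_expectation (f : T -> R) : fine 'E_P[f] = Ex P f.
Proof. by rewrite unlock. Qed.

Lemma fine_variance (f : T -> R) :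
  fine 'V_P[f] = Ex P (fun w => (f w - Ex P f) ^+ 2).
Proof.
rewrite /variance unlock fine_expectation; congr Ex; apply/funext => w.
by rewrite fine_expectation expr2.
Qed.

Lemma trunc_sqrZ (c a : R) (U : T -> R) w : 0 < c ->
  trunc_sqr a (fun w => c * U w) w = c ^+ 2 * trunc_sqr (a / c) U w.
Proof.
move=> c0; rewrite /trunc_sqr normrM (gtr0_norm c0) ltr_pdivrMr// (mulrC c).
by case: ifP => _; rewrite ?mulr0// exprMn mulrC.
Qed.

Let LXs l : Lone P (Xs l).
Proof.
by apply/Lfun1_integrable; apply: Lfun_subset12 => //; exact: fin_num_measure.
Qed.

Let mXs l : measurable_fun setT (Xs l).
Proof. exact: Lone_measurable. Qed.

Let LXs2 l : Lone P (fun w => Xs l w ^+ 2).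
Proof. exact: Lfun2_integrable_sqr. Qed.

Let LD l : Lone P (DeltaX Xs l).
Proof. by case: l => [|l]; [exact: LXs|exact: LoneB]. Qed.

Let mD l : measurable_fun setT (DeltaX Xs l).
Proof. exact: Lone_measurable. Qed.

Let LsqrB (U V : T -> R) : measurable_fun setT U -> measurable_fun setT V ->
  Lone P (fun w => U w ^+ 2) -> Lone P (fun w => V w ^+ 2) ->
  Lone P (fun w => (U w - V w) ^+ 2).
Proof.
move=> mU mV LU LV; apply: (Lone_le _ (LoneD (LoneZ 2 LU) (LoneZ 2 LV))).
  by apply: measurable_funX; exact: measurable_funB.
move=> w; rewrite ger0_norm ?sqr_ge0//.
have := sqr_ge0 (U w + V w); rewrite !expr2; nra.
Qed.

Definition centered_Delta l w := DeltaX Xs l w - Ex P (DeltaX Xs l).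

Lemma measurable_centered_Delta l : measurable_fun setT (centered_Delta l).
Proof. by apply: measurable_funB => //; exact: measurable_cst. Qed.

Let LD2 l : Lone P (fun w => DeltaX Xs l w ^+ 2).
Proof. by case: l => [|l]; [exact: LXs2|exact: LsqrB]. Qed.

Lemma Lone_centered_Delta_sqr l : Lone P (fun w => centered_Delta l w ^+ 2).
Proof.
by apply: LsqrB => //; exact: Lone_cst.
Qed.

Lemma Ex_centered_Delta l : Ex P (centered_Delta l) = 0.
Proof. by rewrite ExB ?Ex_cst ?subrr//; exact: Lone_cst. Qed.

Lemma VlE l : Vl P Xs l = Ex P (fun w => centered_Delta l w ^+ 2).
Proof. by rewrite /Vl fine_variance. Qed.

Lemma Vl_ge0 l : 0 <= Vl P Xs l.
Proof. by rewrite VlE; apply: Ex_ge0 => w; exact: sqr_ge0. Qed.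

Lemma trunc_centered_Delta_le l (a : R) : Ex P (trunc_sqr a (centered_Delta l)) <= Vl P Xs l.
Proof.
rewrite VlE; apply: Ex_le; [|exact: Lone_centered_Delta_sqr|].
  by apply: Lone_trunc_sqr; [exact: measurable_centered_Delta|exact: Lone_centered_Delta_sqr].
by move=> w; rewrite /trunc_sqr; case: ifP => // _; exact: sqr_ge0.
Qed.

Lemma trunc_centered_Delta_anti l (a b : R) : a <= b ->
  Ex P (trunc_sqr b (centered_Delta l)) <= Ex P (trunc_sqr a (centered_Delta l)).
Proof.
move=> ab; have mx := measurable_centered_Delta l; have L := Lone_centered_Delta_sqr l.
apply: Ex_le; [exact: Lone_trunc_sqr|exact: Lone_trunc_sqr|] => w.
rewrite /trunc_sqr; case: ifP => h1; case: ifP => h2 //; last exact: sqr_ge0.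
by move: h2; rewrite (le_lt_trans ab h1).
Qed.

Lemma Ex_Xs n : Ex P (Xs n) = \sum_(0 <= l < n.+1) Ex P (DeltaX Xs l).
Proof.
rewrite -Ex_sum//; congr Ex; apply/funext => w.
elim: n => [|n IH]; first by rewrite big_nat1.
by rewrite big_nat_recr//= -IH addrC subrK.
Qed.

Section normalization.
Variables (n : nat) (M : nat -> nat) (sigma : R).
Hypothesis M0 : forall l, (0 < M l)%N.
Hypothesis sigma0 : 0 < sigma.
Hypothesis sigmaE : sigma ^+ 2 = \sum_(0 <= l < n.+1) Vl P Xs l / (M l)%:R.

(** The double sum over levels and samples is flattened into one duplicate-free list, the form the
    limit theorem for arrays takes. *)
Definition sample_indices : seq (nat * nat) :=
  [seq (l, i) | l <- index_iota 0 n.+1, i <- index_iota 1 (M l).+1].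

Definition normalized_sample (li : nat * nat) (w : T) : R :=
  ((M li.1)%:R * sigma)^-1 * (Y li.1 li.2 w - Ex P (DeltaX Xs li.1)).

Let c l : R := ((M l)%:R * sigma)^-1.

Let Mr0 l : 0 < (M l)%:R :> R. Proof. by rewrite ltr0n. Qed.

Let c0 l : 0 < c l.
Proof. by rewrite invr_gt0 mulr_gt0. Qed.

Let transfer l i (F : R -> R) : measurable_fun setT F ->
  Lone P (fun w => F (centered_Delta l w)) ->
  Lone P (fun w => F (Y l i w - Ex P (DeltaX Xs l))) /\
  Ex P (fun w => F (Y l i w - Ex P (DeltaX Xs l))) = Ex P (fun w => F (centered_Delta l w)).
Proof.
move=> mF LF.
apply: (@Ex_same_law _ _ _ P (Y l i) (DeltaX Xs l)
  (fun x => F (x - Ex P (DeltaX Xs l)))) => //; last exact: hYlaw.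
by apply: (measurableT_comp mF); apply: measurable_funB => //.
Qed.

Let sum_samples (F : nat * nat -> R) :
  \sum_(li <- sample_indices) F li =
  \sum_(0 <= l < n.+1) \sum_(1 <= i < (M l).+1) F (l, i).
Proof. exact: big_allpairs_dep. Qed.

Let Zsqr l i :
  Lone P (fun w => normalized_sample (l, i) w ^+ 2) /\
  Ex P (fun w => normalized_sample (l, i) w ^+ 2) = c l ^+ 2 * Vl P Xs l.
Proof.
have mF : measurable_fun setT (fun x : R => (c l * x) ^+ 2).
  by apply: measurable_funX; exact: mulrl_measurable.
have E : (fun w => (c l * centered_Delta l w) ^+ 2) = (fun w => c l ^+ 2 * centered_Delta l w ^+ 2).
  by apply/funext => w; rewrite exprMn.
have [|LZ EZ] := @transfer l i _ mF; first by rewrite E; apply: LoneZ; exact: Lone_centered_Delta_sqr.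
by split => //; rewrite EZ E ExZ ?VlE//; exact: Lone_centered_Delta_sqr.
Qed.

Lemma normalized_sample_array : lindeberg_array P normalized_sample sample_indices.
Proof.
split.
- move=> [l i]; apply: measurable_funM; first exact: measurable_cst.
  by apply: measurable_funB => //; exact: measurable_cst.
- apply: (mutually_independent_comp (g := fun li x =>
    c li.1 * (x - Ex P (DeltaX Xs li.1))) _ hYind) => li.
  apply: measurable_funM; first exact: measurable_cst.
  by apply: measurable_funB => //; exact: measurable_cst.
- by move=> [l i]; case: (Zsqr l i).
- move=> [l i].
  have mF : measurable_fun setT (fun x : R => c l * x) by exact: mulrl_measurable.
  have Lx : Lone P (centered_Delta l).
    by apply: Lone_sqr; [exact: measurable_centered_Delta|exact: Lone_centered_Delta_sqr].
  have [|_ EZ] := @transfer l i _ mF; first exact: LoneZ.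
  by rewrite [LHS]EZ ExZ// Ex_centered_Delta mulr0.
- apply: allpairs_uniq_dep; [exact: iota_uniq|by move=> l _; exact: iota_uniq|].
  move=> [l i] [l' i'] _ _ /= e.
  by move: (congr1 fst e) (congr1 snd e) => /= -> ->.
rewrite sum_samples.
transitivity (\sum_(0 <= l < n.+1) (sigma ^+ 2)^-1 * (Vl P Xs l / (M l)%:R)).
  apply: eq_bigr => l _.
  rewrite (eq_bigr (fun=> c l ^+ 2 * Vl P Xs l)) => [|i _]; last by case: (Zsqr l i).
  rewrite sumr_const_nat subSS subn0 -mulr_natr /c.
  by field; rewrite !gt_eqF.
by rewrite -mulr_sumr -sigmaE mulVf// gt_eqF// exprn_gt0.
Qed.

(** Level [l] has [M l] summands with equal truncated moments. The scale [c l] passes into the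
    threshold as a division, and [M l * c l ^+ 2] is the reciprocal of [M l * sigma ^+ 2]. *)
Lemma normalized_sample_trunc (delta : R) :
  \sum_(li <- sample_indices) Ex P (trunc_sqr delta (normalized_sample li)) =
  \sum_(0 <= l < n.+1) Ex P (trunc_sqr (delta * ((M l)%:R * sigma)) (centered_Delta l)) /
     ((M l)%:R * sigma ^+ 2).
Proof.
rewrite sum_samples; apply: eq_bigr => l _.
rewrite (eq_bigr (fun=> c l ^+ 2 *
    Ex P (trunc_sqr (delta * ((M l)%:R * sigma)) (centered_Delta l)))) => [|i _].
  rewrite sumr_const_nat subSS subn0 -mulr_natr /c.
  by field; rewrite !gt_eqF.
have mF : measurable_fun setT (trunc_sqr delta (fun x : R => c l * x)).
  by apply: measurable_trunc_sqr; exact: mulrl_measurable.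
have E : (fun w => trunc_sqr delta (fun x : R => c l * x) (centered_Delta l w)) =
    (fun w => c l ^+ 2 * trunc_sqr (delta * ((M l)%:R * sigma)) (centered_Delta l) w).
  apply/funext => w.
  have := trunc_sqrZ delta (centered_Delta l) w (c0 l); rewrite {2}/c invrK => <-.
  by [].
have Lt a : Lone P (trunc_sqr a (centered_Delta l)).
  by apply: Lone_trunc_sqr; [exact: measurable_centered_Delta|exact: Lone_centered_Delta_sqr].
have [|_ EZ] := @transfer l i _ mF; first by rewrite E; exact: LoneZ.
by rewrite -ExZ// -E -EZ.
Qed.

(** The means of the differences telescope to that of [Xs n], so the centred estimator is pointwise
    [sigma] times a sum of variance 1, and its variance is [sigma ^+ 2]. *)
Lemma normalized_estimator :
  let A w := \sum_(0 <= l < n.+1) ((M l)%:R^-1 * \sum_(1 <= i < (M l).+1) Y l i w) in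
  forall w, (A w - fine 'E_P[Xs n]) / Num.sqrt (fine 'V_P[A]) =
    \sum_(li <- sample_indices) normalized_sample li w.
Proof.
move=> A.
have [mZ iZ LZ EZ uJ VJ] := normalized_sample_array.
pose W w := \sum_(li <- sample_indices) normalized_sample li w.
have AE w : A w - Ex P (Xs n) = sigma * W w.
  rewrite /A Ex_Xs -sumrB /W sum_samples mulr_sumr; apply: eq_bigr => l _.
  rewrite /normalized_sample/= -mulr_sumr mulrA.
  rewrite (_ : sigma * _^-1 = (M l)%:R^-1); last by field; rewrite !gt_eqF.
  rewrite sumrB mulrBr; congr (_ - _).
  by rewrite sumr_const_nat subSS subn0 -mulr_natr; field; rewrite gt_eqF.
have LZ1 li : Lone P (normalized_sample li) by exact: Lone_sqr.
have LW : Lone P W by apply: Lone_sum.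
have EW : Ex P W = 0 by rewrite Ex_sum// big1.
have EA : Ex P A = Ex P (Xs n).
  have -> : A = (fun w => sigma * W w + Ex P (Xs n)).
    by apply/funext => w; rewrite -AE subrK.
  by rewrite ExD ?ExZ ?EW ?mulr0 ?add0r ?Ex_cst//; [exact: LoneZ|exact: Lone_cst].
have [LW2 EW2] := Ex_sqr_sum mZ iZ LZ EZ uJ.
have -> : fine 'V_P[A] = sigma ^+ 2.
  rewrite fine_variance EA.
  rewrite (_ : (fun w => _) = (fun w => sigma ^+ 2 * W w ^+ 2)).
    by rewrite ExZ// EW2 VJ mulr1.
  by apply/funext => w; rewrite AE exprMn.
move=> w; rewrite fine_expectation AE sqrtr_sqr gtr0_norm//.
by rewrite mulrC mulKf// gt_eqF.
Qed.

End normalization.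

End multilevel_estimator.

(** * Asymptotics of the multilevel estimator *)

Section asymptotics.
Context {d} {T : measurableType d} {R : realType} (P : probability T R).
Variables (Xs : nat -> T -> R) (Cost : nat -> R) (alpha c_alpha gamma C' : R).
Hypothesis hXs : forall l, Xs l \in Lfun P 2%:E.
Hypotheses (alpha0 : 0 < alpha) (c_alpha0 : 0 < c_alpha) (gamma0 : 0 < gamma).
Hypothesis Cost0 : forall l, 0 < Cost l.
Hypothesis CostC : forall l, Cost l <= C' * expR (gamma * l%:R).
Hypothesis V0 : 0 < Vl P Xs 0.

Let V := Vl P Xs.
Let S := Sk P Xs Cost.
Let b l := Num.sqrt (V l * Cost l).
Let s l := Num.sqrt (V l / Cost l).
Let L := Leps alpha c_alpha.
Let M := Meps P Xs Cost alpha c_alpha.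
Let K1 := c_alpha * expR alpha.

(** At a level of zero variance, division by 0 gives 0, in accordance with the case distinction in
    [cond_star]. *)
Definition trunc_ratio (l : nat) (a : R) := Ex P (trunc_sqr a (centered_Delta P Xs l)) / V l.
Let r := trunc_ratio.

Let tau0 l a : 0 <= Ex P (trunc_sqr a (centered_Delta P Xs l)).
Proof. by apply: Ex_ge0 => w; exact: trunc_sqr_ge0. Qed.

Let Vge0 l : 0 <= V l. Proof. exact: Vl_ge0. Qed.

Let s_ge0 l : 0 <= s l. Proof. exact: sqrtr_ge0. Qed.

Let VE l : V l = s l ^+ 2 * Cost l.
Proof. by rewrite sqr_sqrtr ?divfK ?gt_eqF// divr_ge0// ltW. Qed.

Let bE l : b l = s l * Cost l.
Proof.
by rewrite /b VE -mulrA -expr2 -exprMn sqrtr_sqr ger0_norm// mulr_ge0// ltW.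
Qed.

Let b_ge0 l : 0 <= b l. Proof. exact: sqrtr_ge0. Qed.

Let b00 : 0 < b 0%N. Proof. by rewrite sqrtr_gt0 mulr_gt0. Qed.

Let S_mono k l : (k <= l)%N -> S k <= S l.
Proof.
move=> kl; rewrite /S /Sk (big_cat_nat (leq0n k.+1) (kl : (k.+1 <= l.+1)%N))//= lerDl.
by apply: sumr_ge0 => i _; exact: b_ge0.
Qed.

Let S_ge l : b 0%N <= S l.
Proof. by have := S_mono (leq0n l); rewrite {1}/S /Sk big_nat1. Qed.

Let S0 l : 0 < S l. Proof. exact: lt_le_trans (S_ge l). Qed.

Lemma trunc_ratio_ge0 l a : 0 <= r l a.
Proof. by rewrite divr_ge0. Qed.

Lemma trunc_ratio_le1 l a : r l a <= 1.
Proof.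
have := Vge0 l; rewrite le_eqVlt => /predU1P[v0|v0].
  by rewrite /r /trunc_ratio -v0 invr0 mulr0.
by rewrite ler_pdivrMr// mul1r trunc_centered_Delta_le.
Qed.

Lemma trunc_ratio_anti l a a' : a <= a' -> r l a' <= r l a.
Proof.
by move=> aa; rewrite ler_wpM2r ?invr_ge0//; exact: trunc_centered_Delta_anti.
Qed.

Let M_bounds eps l : eps ^- 2 * s l * S (L eps) <= (M eps l)%:R
  <= eps ^- 2 * s l * S (L eps) + 1.
Proof.
apply: maxn1_ceil; rewrite !mulr_ge0 ?s_ge0 ?(ltW (S0 _))//.
by rewrite invr_ge0 sqr_ge0.
Qed.

Lemma Meps_gt0 eps l : (0 < M eps l)%N.
Proof. by rewrite /M /Meps leq_max orbT. Qed.

(** The bound [M >= eps ^- 2 * s l * S n] is used twice. With [sigma >= sqrt c0 * eps] and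
    [1 / eps >= expR (alpha * n) / K1] it lowers the threshold; in the denominator it gives
    [c0 * s l * S n], and [V l / (s l * S n) = b l / S n]. *)
Lemma lindeberg_sum_le (eps delta c0 sigma : R) :
  0 < eps -> 0 < delta -> 0 < c0 -> 0 < sigma ->
  c0 * eps ^+ 2 <= sigma ^+ 2 -> eps * expR (alpha * (L eps)%:R) <= K1 ->
  \sum_(0 <= l < (L eps).+1)
     Ex P (trunc_sqr (delta * ((M eps l)%:R * sigma)) (centered_Delta P Xs l)) /
     ((M eps l)%:R * sigma ^+ 2) <=
  c0^-1 * \sum_(0 <= l < (L eps).+1) b l / S (L eps) *
     r l (delta * Num.sqrt c0 / K1 * expR (alpha * (L eps)%:R) * s l * S (L eps)).
Proof.
move=> e0 d0 c00 sg0 sg2 eK; rewrite mulr_sumr; apply: ler_sum => l _.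
set n := L eps in eK *; set m := (M eps l)%:R.
have m0 : 0 < m by rewrite ltr0n Meps_gt0.
have Sn0 : 0 < S n by exact: S0.
have K0 : 0 < K1 by rewrite mulr_gt0 ?expR_gt0.
have rhs0 a : 0 <= c0^-1 * (b l / S n * r l a).
  by rewrite mulr_ge0 ?invr_ge0 ?(ltW c00)// mulr_ge0 ?trunc_ratio_ge0// divr_ge0// ltW.
have := Vge0 l; rewrite le_eqVlt => /predU1P[v0|v0].
  apply: le_trans (rhs0 _); rewrite pmulr_lle0 ?invr_gt0 ?mulr_gt0 ?exprn_gt0//.
  by rewrite [leRHS]v0 trunc_centered_Delta_le.
have sl0 : 0 < s l by rewrite sqrtr_gt0 divr_gt0.
have /andP[aM _] := M_bounds eps l.
rewrite -/n -/m in aM.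
have sc : Num.sqrt c0 * eps <= sigma.
  rewrite -(ler_pXn2r (n := 2))// ?nnegrE ?mulr_ge0 ?sqrtr_ge0 ?(ltW e0) ?(ltW sg0)//.
  by rewrite exprMn sqr_sqrtr// ltW.
have thr : delta * Num.sqrt c0 / K1 * expR (alpha * n%:R) * s l * S n <=
    delta * (m * sigma).
  have h1 : expR (alpha * n%:R) / K1 <= eps^-1.
    by rewrite ler_pdivrMr// (mulrC eps^-1) ler_pdivlMr// (mulrC _ eps).
  apply: (@le_trans _ _ (delta * ((eps ^- 2 * s l * S n) * (Num.sqrt c0 * eps)))).
    rewrite (_ : delta * (_ * _) = delta * Num.sqrt c0 * s l * S n * eps^-1); last first.
      by field; rewrite gt_eqF.
    rewrite (_ : _ * s l * S n = delta * Num.sqrt c0 * s l * S n * (expR (alpha * n%:R) / K1)); last by ring.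
    by rewrite ler_wpM2l// !mulr_ge0 ?sqrtr_ge0// ltW.
  rewrite ler_wpM2l ?(ltW d0)//; apply: ler_pM => //.
    by rewrite !mulr_ge0 ?invr_ge0 ?sqr_ge0// ltW.
  by rewrite mulr_ge0 ?sqrtr_ge0// ltW.
have /(trunc_centered_Delta_anti hXs l) tl := thr.
set a := _ * S n in tl thr *.
apply: (@le_trans _ _ (Ex P (trunc_sqr a (centered_Delta P Xs l)) * (c0 * (s l * S n))^-1)).
  apply: ler_pM => //; first by rewrite invr_ge0 mulr_ge0 ?sqr_ge0// ltW.
  rewrite lef_pV2 ?posrE ?mulr_gt0 ?exprn_gt0//.
  apply: (@le_trans _ _ ((eps ^- 2 * s l * S n) * (c0 * eps ^+ 2))).
    by rewrite le_eqVlt; apply/orP; left; apply/eqP; field; rewrite gt_eqF.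
  apply: ler_pM => //.
    by rewrite !mulr_ge0 ?invr_ge0 ?sqr_ge0// ltW.
  by rewrite mulr_ge0 ?sqr_ge0// ltW.
rewrite /r /trunc_ratio bE VE le_eqVlt; apply/orP; left; apply/eqP.
by field; rewrite !gt_eqF ?Cost0.
Qed.

Lemma expR_large (A : R) : exists N, forall n, (N <= n)%N -> A <= expR (alpha * n%:R).
Proof.
have q01 : 0 < expR (- alpha) < 1 by rewrite expR_gt0 expR_lt1 oppr_lt0.
have A0 : 0 < (`|A| + 1)^-1 by rewrite invr_gt0 ltr_wpDl.
have [N HN] := expr_small q01 A0; exists N => n /HN.
rewrite -expRM_natl mulrN expRN lef_pV2 ?posrE ?expR_gt0// 1?ltr_wpDl// mulrC => h.
by rewrite (le_trans _ h)// (le_trans (ler_norm A))// lerDl.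
Qed.

(** For fixed [l] the threshold is at least a positive constant times [expR (alpha * n)], because
    [S n >= b 0]. *)
Lemma trunc_ratio_head (kappa : R) : 0 < kappa -> forall l e, 0 < e ->
  exists N, forall n, (N <= n)%N ->
    r l (kappa * expR (alpha * n%:R) * s l * S n) <= e.
Proof.
move=> k0 l e e0.
have := Vge0 l; rewrite le_eqVlt => /predU1P[v0|v0].
  by exists 0%N => n _; rewrite /r /trunc_ratio -v0 invr0 mulr0 ltW.
have sl0 : 0 < s l by rewrite sqrtr_gt0 divr_gt0.
have eV : 0 < e * V l by rewrite mulr_gt0.
have [A HA] := trunc_sqr_cvg0 (measurable_centered_Delta hXs l) (Lone_centered_Delta_sqr hXs l) eV.
pose c := kappa * s l * b 0%N.
have c0 : 0 < c by rewrite !mulr_gt0.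
have [N HN] := expR_large (A / c); exists N => n /HN {}HN.
rewrite ler_pdivrMr//; apply: HA.
move: HN; rewrite ler_pdivrMr// => /le_trans; apply.
rewrite (_ : _ * S n = expR (alpha * n%:R) * (kappa * s l * S n)); last by ring.
by rewrite ler_wpM2l ?expR_ge0// ler_wpM2l ?S_ge// mulr_ge0// ltW.
Qed.

Definition negligible_tail := forall kappa e : R, 0 < kappa -> 0 < e ->
  exists l0, forall n, \sum_(l0 <= l < n.+1)
    b l / S n * r l (kappa * expR (alpha * n%:R) * s l * S n) <= e.

(** The sum on the right is the variance of the estimator. This and [negligible_tail] are all that
    the three regimes of [beta] and [gamma] have to supply. *)
Definition variance_lower_bound := exists2 c0 : R, 0 < c0 &
  exists N, forall eps, 0 < eps <= 1 -> eps <= c_alpha -> (N <= L eps)%N ->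
  c0 * eps ^+ 2 <= \sum_(0 <= l < (L eps).+1) V l / (M eps l)%:R.

Lemma negligible_lindeberg_sum (kappa e : R) : negligible_tail -> 0 < kappa -> 0 < e ->
  exists N, forall n, (N <= n)%N ->
    \sum_(0 <= l < n.+1) b l / S n * r l (kappa * expR (alpha * n%:R) * s l * S n) <= e.
Proof.
move=> tail k0 e0.
apply: (@weighted_average_to0 _ b
  (fun n l => r l (kappa * expR (alpha * n%:R) * s l * S n))) => //.
- by move=> n l; exact: trunc_ratio_ge0.
- exact: trunc_ratio_head.
- by move=> e' e'0; exact: tail.
Qed.

Lemma geometric_tail (B q : R) : 0 <= B -> 0 < q < 1 ->
  (forall l, b l <= B * q ^+ l) -> negligible_tail.
Proof.
move=> B0 q01 bq kappa e k0 e0; have /andP[q0 q1] := q01.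
(* [B] may vanish, so [B + 1] is the divisor. *)
have c0 : 0 < e * b 0%N * (1 - q) / (B + 1).
  by rewrite divr_gt0 ?ltr_wpDl// mulr_gt0 ?subr_gt0// mulr_gt0.
have [N HN] := expr_small q01 c0.
exists N => n.
apply: (@le_trans _ _ (\sum_(N <= l < n.+1) B * q ^+ l / b 0%N)).
  apply: ler_sum => l _; rewrite -[leRHS]mulr1; apply: ler_pM.
  - by rewrite divr_ge0// ltW.
  - exact: trunc_ratio_ge0.
  - apply: ler_pM => //; first by rewrite invr_ge0 ltW.
    by rewrite lef_pV2 ?posrE.
  - exact: trunc_ratio_le1.
rewrite -mulr_suml -mulr_sumr ler_pdivrMr//.
apply: (@le_trans _ _ (B * (q ^+ N / (1 - q)))).
  by rewrite ler_wpM2l// sum_geometric_tail_le.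
apply: (@le_trans _ _ ((B + 1) * (q ^+ N / (1 - q)))).
  by rewrite ler_wpM2r ?lerDl// divr_ge0 ?exprn_ge0// ?subr_ge0 ltW.
have := HN N (leqnn N); rewrite ler_pdivlMr ?ltr_wpDl// => h.
by rewrite mulrA ler_pdivrMr ?subr_gt0// mulrC.
Qed.

(** Level 0 suffices: [eps <= 1] absorbs the rounding, so [M eps 0] is at most
    [eps ^- 2 * (s 0 * B + 1)]. *)
Lemma bounded_variance_lower_bound (B : R) : (forall n, S n <= B) ->
  variance_lower_bound.
Proof.
move=> SB; pose c := s 0%N * B + 1.
have B0 : 0 <= B by rewrite (le_trans _ (SB 0%N))// ltW.
have c0 : 0 < c by rewrite ltr_wpDl// mulr_ge0.
exists (V 0%N / c); first by rewrite divr_gt0.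
exists 0%N => eps /andP[e0 e1] _ _.
rewrite big_nat_recl//; apply: (@le_trans _ _ (V 0%N / (M eps 0%N)%:R)); last first.
  by rewrite lerDl; apply: sumr_ge0 => l _; rewrite divr_ge0.
rewrite -mulrA ler_wpM2l// mulrC ler_pdivrMr// mulrC ler_pdivlMr ?ltr0n ?Meps_gt0//.
have /andP[_ h] := M_bounds eps 0%N.
rewrite -ler_pdivlMl ?exprn_gt0//; apply: (le_trans h).
rewrite /c mulrDr mulr1 mulrA; apply: lerD.
  by rewrite ler_wpM2l// mulr_ge0// invr_ge0 sqr_ge0.
by rewrite invf_ge1 ?exprn_gt0// expr_le1// ltW.
Qed.

(** Without rounding the variance would be exactly [eps ^+ 2] when all [s l > 0]. Rounding loses at
    most [u ^+ 2] times the total cost, a geometric sum of order [expR (gamma * n)]; the choice of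
    level and the growth of [S] bound this loss by half of [eps ^+ 2]. *)
Lemma growth_variance_lower_bound :
  (forall k : R, 0 < k -> exists N, forall n, (N <= n)%N ->
     expR ((gamma - 2 * alpha) * n%:R) <= k * S n ^+ 2) ->
  variance_lower_bound.
Proof.
move=> growth; pose p := expR gamma.
have p1 : 1 < p by rewrite expR_gt1.
have C'0 : 0 < C'.
  by have := lt_le_trans (Cost0 0) (CostC 0); rewrite mulr0 expR0 mulr1.
have K0 : 0 < K1 by rewrite mulr_gt0 ?expR_gt0.
(* [D] collects the constants in the bound of [eps ^+ 2] times the total cost by
   [expR ((gamma - 2 * alpha) * n)]; growth with constant [(2 * D)^-1] then leaves one half. *)
pose D := C' * (p / (p - 1)) * K1 ^+ 2.
have D0 : 0 < D.
  rewrite !mulr_gt0 ?exprn_gt0 ?invr_gt0 ?subr_gt0//; exact: expR_gt0.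
have Dinv0 : 0 < (2 * D)^-1 by rewrite invr_gt0 mulr_gt0.
have [N HN] := growth (2 * D)^-1 Dinv0.
exists 2^-1; first by rewrite invr_gt0.
exists N => eps /andP[e0 e1] ec NL; set n := L eps in NL *.
have {}HN := HN _ NL.
(* With a_l = s_l / u the unrounded sample size,
   V_l / (a_l + 1) = u s_l^2 C_l / (s_l + u) >= u C_l (s_l - u). *)
pose u := eps ^+ 2 / S n.
have u0 : 0 < u by rewrite divr_gt0 ?exprn_gt0.
have step l : u * (b l - u * Cost l) <= V l / (M eps l)%:R.
  have m0 : 0 < (M eps l)%:R :> R by rewrite ltr0n Meps_gt0.
  have /andP[_ h] := M_bounds eps l.
  have su1 : 0 < s l / u + 1 by rewrite ltr_wpDl// mulr_ge0// invr_ge0 ltW.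
  apply: (@le_trans _ _ (V l / (s l / u + 1))); last first.
    rewrite ler_wpM2l// lef_pV2 ?posrE//.
    apply: (le_trans h); rewrite lerD2r /u invf_div le_eqVlt; apply/orP; left.
    by apply/eqP; rewrite /n; ring.
  have su : 0 < s l + u by rewrite ltr_wpDl.
  rewrite (_ : V l / _ = s l ^+ 2 * Cost l * u / (s l + u)); last first.
    by rewrite VE; field; rewrite !gt_eqF// ltr_wpDl// mulr_ge0// ltW.
  rewrite ler_pdivlMr// bE.
  rewrite (_ : u * _ * _ = (s l ^+ 2 - u ^+ 2) * Cost l * u); last by ring.
  rewrite ler_wpM2r ?(ltW u0)// ler_wpM2r ?(ltW (Cost0 l))//.
  by rewrite gerBl sqr_ge0.
apply: (@le_trans _ _ (\sum_(0 <= l < n.+1) u * (b l - u * Cost l))); last first.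
  by apply: ler_sum => l _; exact: step.
rewrite -mulr_sumr sumrB -mulr_sumr -/(S n).
have sumC : \sum_(0 <= l < n.+1) Cost l <= C' * (p / (p - 1) * p ^+ n).
  apply: (@le_trans _ _ (\sum_(0 <= l < n.+1) C' * p ^+ l)).
    apply: ler_sum => l _; apply: (le_trans (CostC l)).
    by rewrite mulrC mulr_natr /p -expRM_natr mulr_natr mulrC.
  by rewrite -mulr_sumr ler_wpM2l ?(ltW C'0)// sum_geometric_le.
have ep : eps ^+ 2 * p ^+ n <= K1 ^+ 2 * expR ((gamma - 2 * alpha) * n%:R).
  have := Leps_expR_le alpha0 e0 ec; rewrite -/K1 -/(L eps) -/n => h.
  have h2 : (eps * expR (alpha * n%:R)) ^+ 2 <= K1 ^+ 2.
    by apply: lerXn2r => //; rewrite nnegrE ?mulr_ge0 ?expR_ge0// ltW.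
  rewrite (_ : eps ^+ 2 * p ^+ n =
    (eps * expR (alpha * n%:R)) ^+ 2 * expR ((gamma - 2 * alpha) * n%:R)).
    by rewrite ler_wpM2r// expR_ge0.
  rewrite /p -expRM_natl exprMn -[RHS]mulrA; congr (_ * _).
  by rewrite -expRM_natl -expRD; congr expR; ring.
have key : eps ^+ 2 * \sum_(0 <= l < n.+1) Cost l <= 2^-1 * S n ^+ 2.
  apply: (@le_trans _ _ (C' * (p / (p - 1)) * (eps ^+ 2 * p ^+ n))).
    rewrite [leRHS]mulrCA -[C' * _ * _]mulrA.
    by rewrite ler_wpM2l// sqr_ge0.
  apply: (@le_trans _ _ (D * ((2 * D)^-1 * S n ^+ 2))).
    rewrite /D -[leRHS]mulrA ler_wpM2l ?(le_trans ep)//.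
      by rewrite mulr_ge0 ?(ltW C'0)// divr_ge0 ?subr_ge0 ?(ltW p1)// expR_ge0.
    by rewrite ler_wpM2l// sqr_ge0.
  by rewrite le_eqVlt; apply/orP; left; apply/eqP; field; rewrite gt_eqF.
rewrite mulrBr (_ : u * S n = eps ^+ 2); last by rewrite /u divfK// gt_eqF.
suff h : u * (u * \sum_(0 <= l < n.+1) Cost l) <= 2^-1 * eps ^+ 2.
  rewrite lerBrDl; apply: (le_trans (lerD h (lexx _))).
  by rewrite -mulrDl -div1r -splitr mul1r.
rewrite (_ : u * (u * _) = eps ^+ 2 / S n ^+ 2 * (eps ^+ 2 * \sum_(0 <= l < n.+1) Cost l)); last first.
  by rewrite /u; field; rewrite gt_eqF.
apply: (@le_trans _ _ (eps ^+ 2 / S n ^+ 2 * (2^-1 * S n ^+ 2))).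
  by rewrite ler_wpM2l// divr_ge0 ?sqr_ge0.
by rewrite le_eqVlt; apply/orP; left; apply/eqP; field; rewrite gt_eqF.
Qed.

(** [cond_star] truncates the normalised square; multiplying its level by [V l] and taking the root
    gives the threshold for [|centered_Delta|]. *)
Lemma star_trunc_ratio (nu e : R) : cond_star P Xs Cost alpha gamma ->
  0 < nu -> 0 < e ->
  exists N, forall l, (N <= l)%N -> 0 < V l ->
    r l (Num.sqrt (nu * S l ^+ 2 * expR ((2 * alpha - gamma) * l%:R) * V l)) <= e.
Proof.
move=> star nu0 e0.
have /fine_cvgP[_ /cvgr0Pnorm_le/(_ _ e0)[N _ HN]] := star _ nu0.
exists N => l /HN /=; rewrite -/(V l) => + v0; rewrite v0.
rewrite fine_expectation fine_expectation; apply: le_trans.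
apply: le_trans (ler_norm _).
set t := nu * _ * _.
have t0 : 0 <= t by rewrite !mulr_ge0 ?expR_ge0 ?sqr_ge0// ltW.
have tV : 0 <= t * V l by exact: mulr_ge0.
rewrite /r /trunc_ratio mulrC -ExZ; last first.
  by apply: Lone_trunc_sqr; [exact: measurable_centered_Delta|exact: Lone_centered_Delta_sqr].
rewrite le_eqVlt; apply/orP; left; apply/eqP; congr Ex; apply/funext => w.
rewrite /trunc_sqr -/(centered_Delta P Xs l w) real_normK ?num_real//.
have -> : (t < centered_Delta P Xs l w ^+ 2 / V l) = (Num.sqrt (t * V l) < `|centered_Delta P Xs l w|).
  rewrite ltr_pdivlMr// -[RHS](ltr_pXn2r (n := 2))// ?nnegrE ?sqrtr_ge0//.
  by rewrite (sqr_sqrtr tV) real_normK ?num_real.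
by case: ifP => _; rewrite ?mulr0// mulr1 mulrC.
Qed.

Lemma star_tail : cond_star P Xs Cost alpha gamma -> negligible_tail.
Proof.
move=> star kappa e k0 e0.
have C'0 : 0 < C'.
  by have := lt_le_trans (Cost0 0) (CostC 0); rewrite mulr0 expR0 mulr1.
(* With this [nu], [V l = s l ^+ 2 * Cost l] and the cost bound put the threshold of [cond_star] at
   level [l] below the required one for every [n >= l]. *)
have nu0 : 0 < kappa ^+ 2 / C' by rewrite divr_gt0 ?exprn_gt0.
have [N HN] := star_trunc_ratio star nu0 e0; exists N => n.
apply: (@le_trans _ _ (\sum_(N <= l < n.+1) b l / S n * e)).
  rewrite big_nat_cond [leRHS]big_nat_cond; apply: ler_sum => l /andP[/andP[Nl ln] _].
  rewrite ler_wpM2l ?divr_ge0 ?(ltW (S0 _))//.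
  have := Vge0 l; rewrite le_eqVlt => /predU1P[v0|v0].
    by rewrite /r /trunc_ratio -v0 invr0 mulr0 ltW.
  apply: le_trans (HN l Nl v0); apply: trunc_ratio_anti.
  have y0 : 0 <= kappa * expR (alpha * n%:R) * s l * S n.
    by rewrite !mulr_ge0 ?expR_ge0// ltW.
  rewrite -[leRHS](ger0_norm y0) -sqrtr_sqr ler_wsqrtr//.
  rewrite VE !exprMn.
  have h1 : expR (- (gamma * l%:R)) / C' * Cost l <= 1.
    by rewrite mulrAC ler_pdivrMr// mul1r expRN [leLHS]mulrC ler_pdivrMr ?expR_gt0.
  have h2 : S l ^+ 2 <= S n ^+ 2.
    by apply: lerXn2r; rewrite ?nnegrE ?(ltW (S0 _))//; exact: S_mono.
  have h3 : expR (alpha * l%:R) ^+ 2 <= expR (alpha * n%:R) ^+ 2.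
    apply: lerXn2r; rewrite ?nnegrE ?expR_ge0// ler_expR ler_wpM2l ?(ltW alpha0)//.
    by rewrite ler_nat.
  have eE : expR ((2 * alpha - gamma) * l%:R) =
      expR (alpha * l%:R) ^+ 2 * expR (- (gamma * l%:R)).
    by rewrite -expRM_natl -expRD; congr expR; ring.
  rewrite eE (_ : _ * (s l ^+ 2 * Cost l) = (expR (- (gamma * l%:R)) / C' * Cost l) *
    (kappa ^+ 2 * s l ^+ 2 * (S l ^+ 2 * expR (alpha * l%:R) ^+ 2))); last by ring.
  rewrite (_ : kappa ^+ 2 * _ * _ * _ = 1 *
    (kappa ^+ 2 * s l ^+ 2 * (S n ^+ 2 * expR (alpha * n%:R) ^+ 2))); last by ring.
  apply: ler_pM => //.
  - by rewrite mulr_ge0 ?(ltW (Cost0 _))// divr_ge0 ?expR_ge0// ltW.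
  - by do ![exact: sqr_ge0|apply: mulr_ge0].
  - apply: ler_wpM2l; first by do ![exact: sqr_ge0|apply: mulr_ge0].
    by apply: ler_pM => //; exact: sqr_ge0.
rewrite -mulr_suml -mulr_suml ler_piMl ?(ltW e0)//.
rewrite ler_pdivrMr// mul1r /S /Sk.
have [Nn|nN] := leqP N n.+1; last by rewrite big_geq ?(ltnW nN)// (ltW (S0 n)).
rewrite [leRHS](big_cat_nat (leq0n N) Nn)//= lerDr.
by apply: sumr_ge0 => i _; exact: b_ge0.
Qed.

End asymptotics.

(** * The three regimes and the limit in distribution *)

Unset Implicit Arguments.

Theorem theorem1 (R : realType) (d : measure_display) (T : measurableType d)
  (P : probability T R)
  (X : T -> R) (Xs : nat -> T -> R) (Cost : nat -> R)
  (Y : nat -> nat -> T -> R)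
  (alpha beta gamma c_alpha : R)
  (* X and the X_l are in L^2 *)
  (hX : X \in Lfun P 2%:E)
  (hXs : forall l, Xs l \in Lfun P 2%:E)
  (* the samples Y l i = Delta_l X^i: mutually independent, with the law of Delta_l X *)
  (hYm : forall l i, measurable_fun setT (Y l i))
  (hYind : mutually_independent P (fun li : nat * nat => Y li.1 li.2))
  (hYlaw : forall l i (B : set R), measurable B ->
             P (Y l i @^-1` B) = P (DeltaX Xs l @^-1` B))
  (* Assumption A *)
  (halpha : 0 < alpha) (hbeta : 0 < beta) (hgamma : 0 < gamma)
  (hmin : Num.min beta gamma <= 2 * alpha) (hcalpha : 0 < c_alpha)
  (hbias : forall l : nat,
     (`| 'E_P[X \- Xs l] | <= (c_alpha * expR (- alpha * l%:R))%:E)%E)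
  (hvar : exists C : R, 0 < C /\
     forall l : nat, Vl P Xs l <= C * expR (- beta * l%:R))
  (hcost : exists c C' : R, 0 < c /\ c < C' /\
     forall l : nat, c * expR (gamma * l%:R) < Cost l < C' * expR (gamma * l%:R))
  (* further hypotheses of the theorem *)
  (hV0 : 0 < Vl P Xs 0)
  (hi : beta = gamma ->
     Sk P Xs Cost @ \oo --> +oo /\ cond_star P Xs Cost alpha gamma)
  (hii : beta < gamma ->
     [/\ beta < 2 * alpha, cond_star P Xs Cost alpha gamma &
         exists ups : R, beta <= ups < 2 * alpha /\
           (1 < limn_einf (fun k : nat =>
              (Sk P Xs Cost k * expR ((ups - gamma) * k%:R / 2))%:E))%E]) :
  forall x : R,
    (fun eps : R =>
       P [set w | (A_ML P Xs Cost Y alpha c_alpha eps w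
                   - fine 'E_P[Xs (Leps alpha c_alpha eps)])
                  / Num.sqrt (fine 'V_P[A_ML P Xs Cost Y alpha c_alpha eps]) <= x])
    @ at_right 0 --> normal_prob 0 1 `]-oo, x].
Proof.
have [Cv [Cv0 hV]] := hvar.
have [c [C' [c0 [cC' hC]]]] := hcost.
have Cost0 l : 0 < Cost l.
  by have /andP[h _] := hC l; rewrite (lt_trans _ h)// mulr_gt0 ?expR_gt0.
have CostC l : Cost l <= C' * expR (gamma * l%:R) by have /andP[_ /ltW] := hC l.
have C'0 : 0 < C' by exact: lt_trans cC'.
have S0 k : 0 <= Sk P Xs Cost k by apply: sumr_ge0 => l _; exact: sqrtr_ge0.
have [tail var] : negligible_tail P Xs Cost alpha /\
    variance_lower_bound P Xs Cost alpha c_alpha.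
  have [bg|gb|bg] := ltgtP beta gamma.
  (* The lower limit gives [S n > expR ((gamma - ups) * n / 2)] eventually, so [S n ^+ 2] beats
     [expR ((gamma - 2 * alpha) * n)] by a geometric factor, as [ups < 2 * alpha]. *)
  - have [b2a star [ups [/andP[bu u2a] hl]]] := hii bg.
    split; first exact: (star_tail hXs halpha Cost0 CostC hV0 star).
    apply: (growth_variance_lower_bound halpha hcalpha hgamma Cost0 CostC hV0).
    move=> k k0; have [N1 HN1] := limn_einf_gt hl.
    have q01 : 0 < expR (ups - 2 * alpha) < 1.
      by rewrite expR_gt0 expR_lt1 subr_lt0.
    have [N2 HN2] := expr_small q01 k0.
    exists (maxn N1 N2) => n; rewrite geq_max => /andP[/HN1 h1 /HN2 h2].
    have -> : expR ((gamma - 2 * alpha) * n%:R) =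
        expR (ups - 2 * alpha) ^+ n * expR ((gamma - ups) * n%:R / 2) ^+ 2.
      by rewrite -!expRM_natl -expRD; congr expR; field.
    apply: ler_pM => //; rewrite ?exprn_ge0 ?expR_ge0//.
    apply: lerXn2r; rewrite ?nnegrE ?expR_ge0//.
    have -> : expR ((gamma - ups) * n%:R / 2) = (expR ((ups - gamma) * n%:R / 2))^-1.
      by rewrite -expRN; congr expR; ring.
    by rewrite -div1r ler_pdivrMr ?expR_gt0// ltW.
  (* Here [V l * Cost l] decays like [expR ((gamma - beta) * l)], so the weights are dominated by a
     geometric sequence and [S] is bounded. *)
  - pose q := expR ((gamma - beta) / 2); pose B := Num.sqrt (Cv * C').
    have q01 : 0 < q < 1 by rewrite expR_gt0 expR_lt1 pmulr_llt0 ?invr_gt0// subr_lt0.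
    have bq l : Num.sqrt (Vl P Xs l * Cost l) <= B * q ^+ l.
      have ql : 0 <= q ^+ l by rewrite exprn_ge0 ?expR_ge0.
      rewrite -[q ^+ l]ger0_norm// -sqrtr_sqr -sqrtrM ?mulr_ge0 ?(ltW Cv0) ?(ltW C'0)//.
      apply: ler_wsqrtr.
      rewrite (_ : Cv * C' * _ = (Cv * expR (- beta * l%:R)) * (C' * expR (gamma * l%:R))).
        by apply: ler_pM => //; [exact: Vl_ge0|exact: ltW].
      rewrite [RHS]mulrACA -expRD /q -expRM_natl -expRM_natl; congr (_ * expR _).
      by field.
    split; first exact: (geometric_tail _ hXs Cost0 hV0 (sqrtr_ge0 _) q01 bq).
    apply: (bounded_variance_lower_bound _ _ Cost0 hV0 (B := B / (1 - q))) => n.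
    apply: (@le_trans _ _ (\sum_(0 <= l < n.+1) B * q ^+ l)).
      by apply: ler_sum => l _; exact: bq.
    rewrite -mulr_sumr ler_wpM2l ?sqrtr_ge0//.
    by rewrite (le_trans (sum_geometric_tail_le 0 n.+1 q01))// expr0 mul1r.
  - have [Soo star] := hi bg.
    split; first exact: (star_tail hXs halpha Cost0 CostC hV0 star).
    apply: (growth_variance_lower_bound halpha hcalpha hgamma Cost0 CostC hV0).
    move=> k k0.
    (* Both [S n >= 1 / k] and [S n >= 1] follow, hence [k * S n ^+ 2 >= 1]; the exponential is at
       most 1 because [gamma <= 2 * alpha] when [beta = gamma]. *)
    have /cvgryPge/(_ (k^-1 + 1))[N _ HN] := Soo.
    exists N => n /HN /= Sn.
    apply: (@le_trans _ _ 1).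
      rewrite -[leRHS]expR0 ler_expR mulr_le0_ge0//.
      by move: hmin; rewrite bg minxx subr_le0.
    have k1 : 0 < k^-1 by rewrite invr_gt0.
    rewrite mulrC -ler_pdivrMr// div1r expr2.
    apply: (@le_trans _ _ (Sk P Xs Cost n * 1)); first by rewrite mulr1; lra.
    by rewrite ler_wpM2l//; lra.
move=> x; pose K1 := c_alpha * expR alpha.
have K10 : 0 < K1 by rewrite mulr_gt0 ?expR_gt0.
have [c1 c10 [N1 HN1]] := var.
pose F eps := P [set w | (A_ML P Xs Cost Y alpha c_alpha eps w
                   - fine 'E_P[Xs (Leps alpha c_alpha eps)])
                  / Num.sqrt (fine 'V_P[A_ML P Xs Cost Y alpha c_alpha eps]) <= x].
have key (e : R) : 0 < e -> \forall eps \near 0^'+,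
    F eps \is a fin_num /\ `|fine (normal_prob 0 1 `]-oo, x]) - fine (F eps)| <= e.
  move=> e0.
  have [delta [t [delta0 t0 clt]]] := @lindeberg_cdf _ T R P (nat * nat)%type x e e0.
  (* This is the threshold constant of [lindeberg_sum_le]; the target [t * c1] below compensates its
     factor [c0^-1]. *)
  have kappa0 : 0 < delta * Num.sqrt c1 / K1 by rewrite divr_gt0// mulr_gt0// sqrtr_gt0.
  have tc0 : 0 < t * c1 by exact: mulr_gt0.
  have [N2 HN2] := negligible_lindeberg_sum hXs halpha Cost0 hV0 tail kappa0 tc0.
  pose N := maxn N1 N2.
  near=> eps.
  have eps0 : 0 < eps by [].
  have eps1 : eps <= 1 by near: eps; exact: nbhs_right_le.
  have epsc : eps <= c_alpha by near: eps; exact: nbhs_right_le.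
  have epsN : eps <= c_alpha * expR (- (alpha * N%:R)).
    by near: eps; apply: nbhs_right_le; rewrite mulr_gt0 ?expR_gt0.
  have NL : (N <= Leps alpha c_alpha eps)%N by exact: Leps_ge.
  have e01 : 0 < eps <= 1 by rewrite eps0.
  have hvarL := HN1 eps e01 epsc (leq_trans (leq_maxl _ _) NL).
  set L := Leps alpha c_alpha eps in NL hvarL *.
  pose M := Meps P Xs Cost alpha c_alpha eps.
  pose sg2 := \sum_(0 <= l < L.+1) Vl P Xs l / (M l)%:R.
  have sg20 : 0 < sg2 by rewrite (lt_le_trans _ hvarL)// mulr_gt0 ?exprn_gt0.
  pose sigma := Num.sqrt sg2.
  have sigma0 : 0 < sigma by rewrite sqrtr_gt0.
  have sigmaE : sigma ^+ 2 = sg2 by rewrite sqr_sqrtr// ltW.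
  have M0 l : (0 < M l)%N by exact: Meps_gt0.
  have arr := normalized_sample_array hXs hYm hYind hYlaw M0 sigma0 sigmaE.
  have Weq : [set w | (A_ML P Xs Cost Y alpha c_alpha eps w - fine 'E_P[Xs L])
        / Num.sqrt (fine 'V_P[A_ML P Xs Cost Y alpha c_alpha eps]) <= x] =
      [set w | \sum_(li <- sample_indices L M) normalized_sample P Xs Y M sigma li w <= x].
    apply/seteqP; split => w /=;
      by rewrite -(normalized_estimator hXs hYm hYind hYlaw M0 sigma0 sigmaE).
  rewrite /F -/L Weq; split.
    apply: fin_num_measure.
    rewrite (_ : [set w | _] =
      (fun w => \sum_(li <- sample_indices L M) normalized_sample P Xs Y M sigma li w)
        @^-1` `]-oo, x]); last by apply/seteqP; split => w /=; rewrite in_itv.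
    by apply: measurable_preimage => //; apply: measurable_sum; case: arr.
  rewrite distrC; apply: clt => //.
  rewrite (normalized_sample_trunc hXs hYm hYlaw _ M0 sigma0).
  apply: (le_trans (lindeberg_sum_le hXs hcalpha Cost0 hV0 eps0 delta0 c10 sigma0 _ _)).
  - by rewrite sigmaE.
  - exact: Leps_expR_le.
  rewrite ler_pdivrMl// (mulrC c1); apply: HN2.
  exact: leq_trans (leq_maxr _ _) NL.
have nf : normal_prob 0 1 `]-oo, x] = (fine (normal_prob 0 1 `]-oo, x]))%:E.
  by rewrite normal_probE.
rewrite nf; apply/fine_cvgP; split.
  by apply: filterS (key 1 ltr01) => eps [].
apply/cvgrPdist_le => e e0; apply: filterS (key e e0) => eps [_].
by rewrite nf.
Unshelve. all: by end_near. Qed.
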